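(* Let $f$ be a function in $L^2(S_1)$, and let $$K_t^{S_1}(y):=\frac1{2\pi}\sum_{k=-\infty}^{+\infty}e^{-k^2t}e^{iky}=\frac1{2\pi}+\frac1\pi\sum_{k=1}^{+\infty}e^{-k^2t}\cos(ky),\qquad t>0,$$ be the heat kernel of the unit circle. Then $f\in H^1(S_1)$ if and only if $$J_t^{S_1}(f):=\frac1t\left(\|f\|_{L^2(S_1)}^2-\int_{-\pi}^\pi\int_{-\pi}^\pi K_t^{S_1}(y_1-y_2)f(y_1)f(y_2)\,dy_1\,dy_2\right)$$ is uniformly bounded in $t\in(0,+\infty)$. In this case, $J_t^{S_1}(f)$ is nonincreasing in $t$, and $$\|f'\|_{L^2(S_1)}^2=\lim_{t\to0^+}J_t^{S_1}(f).$$
   Context: $S_1$ is the unit circle, identified with $[-\pi,\pi]$ with endpoints glued; $H^1(S_1)$ is the set of $f\in H^1([-\pi,\pi])$ with $f(-\pi)=f(\pi)$. Functions are real-valued. *)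

(* Defs.v *)
From HB Require Import structures.
From mathcomp Require Import all_boot all_order all_algebra.
From mathcomp Require Import complex.
From mathcomp Require Import all_classical all_reals all_analysis.

Set Implicit Arguments.
Unset Strict Implicit.
Unset Printing Implicit Defensive.

Import Order.TTheory GRing.Theory Num.Theory.
Import numFieldNormedType.Exports.

Local Open Scope classical_set_scope.
Local Open Scope complex_scope.
Local Open Scope ring_scope.

(* Functions on the circle are represented by functions R -> R of which only
   the values on the fundamental interval [-pi, pi] are ever used. *)
Definition circle (R : realType) : set R := `[- pi, pi]%classic.

(* The restriction f \_ circle extends f by 0 outside [-pi, pi], so that no
   measurability is required of f outside that interval. *)
Definition L2_circle (R : realType) (f : R -> R) : Prop :=
  f \_ (@circle R) \in Lfun (@lebesgue_measure R) 2%:E.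

Definition L2norm (R : realType) (f : R -> R) : R :=
  fine ('N[@lebesgue_measure R]_2%:E [EFin \o f \_ (@circle R)]).

(* C^infinity functions with compact support in the open interval
   ]-pi, pi[ *)
Definition test_function (R : realType) (phi : R -> R) : Prop :=
  (forall (n : nat) (x : R), derivable (phi^`(n))%classic x 1) /\
  (exists a b : R, [/\ - pi < a, b < pi &
     forall x : R, x \notin `[a, b] -> phi x = 0]).

Definition weak_derivative (R : realType) (f g : R -> R) : Prop :=
  L2_circle g /\
  forall phi : R -> R, test_function phi ->
    \int[@lebesgue_measure R]_(x in @circle R) (f x * (phi^`())%classic x) =
    - \int[@lebesgue_measure R]_(x in @circle R) (g x * phi x).

Definition H1_interval (R : realType) (f : R -> R) : Prop :=
  L2_circle f /\ exists g : R -> R, weak_derivative f g.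

(* f(-pi) = f(pi) is understood for the continuous representative of f on the
   closed interval [-pi, pi]. *)
Definition H1_circle (R : realType) (f : R -> R) : Prop :=
  H1_interval f /\
  exists F : R -> R,
    [/\ {within @circle R, continuous F},
        {ae @lebesgue_measure R, forall x, circle x -> F x = f x} &
        F (- pi) = F pi].

Definition heat_kernel (R : realType) (t y : R) : R :=
  (2 * pi)^-1 +
  pi^-1 * \big[+%R/0]_(1 <= k <oo) (expR (- (k%:R ^+ 2 * t)) * cos (k%:R * y)).

Definition expi (R : realType) (x : R) : R[i] := cos x +i* sin x.

(* Both one-sided series are required to converge. *)
Definition has_bilateral_sum (K : numFieldType) (u : int -> K) (s : K)
    : Prop :=
  exists a b : K,
    [/\ series (fun n : nat => u n%:Z) @ \oo --> a,
        series (fun n : nat => u (- n.+1%:Z)) @ \oo --> b &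
        s = a + b].

Definition J (R : realType) (f : R -> R) (t : R) : R :=
  t^-1 * (L2norm f ^+ 2 -
    \int[@lebesgue_measure R]_(y1 in @circle R)
      \int[@lebesgue_measure R]_(y2 in @circle R)
        (heat_kernel t (y1 - y2) * f y1 * f y2)).

(* Main.v *)
(** With [q_k] the squared norm of the component of [f] of frequency [k],
    Parseval's identity gives [|f|^2 = sum q_k], and expanding the kernel gives
    [e^(- k^2 t) q_k] for the terms of the double integral, so that
    [J f t = sum_k ((1 - e^(- k^2 t)) / t) q_k]. Each weight
    [(1 - e^(- k^2 t)) / t] increases to [k^2] as [t] decreases to 0; hence
    [J f] is nonincreasing, and it is bounded iff [sum k^2 q_k] is finite, in
    which case this sum is its limit at 0. It remains to compare with [H^1].
    If [g] is a weak derivative of [f], testing against smooth cutoffs of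
    [cos (k x)] and [sin (k x)] shows that the coefficients of [g] are those of
    the termwise derivative of the Fourier series of [f] (the boundary terms
    cancel because the continuous representative takes the same value at the
    two ends), so that [|g|^2 = sum k^2 q_k]. Conversely, if [sum k^2 q_k] is
    finite then the Fourier series of [f] converges uniformly, and the
    Riesz-Fischer theorem sums its termwise derivative to a weak derivative. *)
Require Import Defs.
From HB Require Import structures.
From mathcomp Require Import all_boot all_order all_algebra.
From mathcomp Require Import complex.
From mathcomp Require Import all_classical all_reals all_analysis.
From mathcomp Require Import measurable_realfun.
From mathcomp Require Import ring lra.

Set Implicit Arguments.
Unset Strict Implicit.
Unset Printing Implicit Defensive.

Import Order.TTheory GRing.Theory Num.Theory.
Import numFieldNormedType.Exports.

Local Open Scope classical_set_scope.
Local Open Scope complex_scope.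
Local Open Scope ring_scope.

(** * Square integrable functions on the circle *)

Section square_integrable.
Context {R : realType}.
Notation mu := (@lebesgue_measure R).
Notation D := (@circle R).
Notation intg f := (mu.-integrable D (EFin \o f)).
Implicit Types f g h : R -> R.

(** Frequencies k and -k are merged into one real block spanned by [cosn k] and [sinn k], so complex
    numbers occur only in the bilateral form of the kernel. Parseval rests on completeness of the
    trigonometric system: bounded trigonometric polynomials converging to indicators of small
    intervals show that a function with zero coefficients has zero mean on each of them, and
    Lebesgue differentiation concludes. Functions are never identified modulo null sets; L2 limits
    enter only through [riesz_fischer], whose conclusion is weak convergence. The obstacle for weak
    derivatives is that test functions vanish near both ends while the waves do not. The derivative
    of a cutoff has size N on strips of width 1/N and does not tend to 0 in L1; only its vanishing
    integral, together with the equal boundary values of the continuous representative, removes its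
    contribution. *)

Definition sqint f :=
  measurable_fun D f /\ intg (fun x => f x ^+ 2).

Definition ip f g : R := \int[mu]_(x in D) (f x * g x).

Lemma ae_mono (P Q : R -> Prop) : (forall x, P x -> Q x) ->
  {ae mu, forall x, P x} -> {ae mu, forall x, Q x}.
Proof. by move=> PQ; apply: filterS; first exact: (ae_filter_ringOfSetsType mu). Qed.

Lemma ae_and (P Q : R -> Prop) :
  {ae mu, forall x, P x} -> {ae mu, forall x, Q x} ->
  {ae mu, forall x, P x /\ Q x}.
Proof. exact: (@filterI _ _ (ae_filter_ringOfSetsType mu)). Qed.

Lemma measurable_circle : measurable D.
Proof. exact: measurable_itv. Qed.
Hint Resolve measurable_circle : core.

Lemma circle_lt : - pi < pi :> R.
Proof. by have := pi_gt0 R; lra. Qed.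

Lemma mu_circle : mu D = (2 * pi)%:E.
Proof.
rewrite /circle lebesgue_measure_itv/= lte_fin circle_lt.
by rewrite -EFinB; congr EFin; ring.
Qed.

Lemma intg_mono f g : measurable_fun D f -> intg g ->
  (forall x, D x -> `|f x| <= g x) -> intg f.
Proof.
move=> mf ig fg; apply: (le_integrable _ _ _ ig) => //.
- exact/measurable_EFinP.
- move=> x Dx /=; rewrite lee_fin (le_trans (fg _ Dx))//; exact: ler_norm.
Qed.

Lemma intgD f g : intg f -> intg g -> intg (fun x => f x + g x).
Proof. by move=> fi gi; apply: (eq_integrable _ _ _ _ (integrableD _ fi gi)). Qed.

Lemma intgZ k f : intg f -> intg (fun x => k * f x).
Proof. by move=> fi; apply: (eq_integrable _ _ _ _ (integrableZl _ k fi)). Qed.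

Lemma intgB f g : intg f -> intg g -> intg (fun x => f x - g x).
Proof. by move=> fi gi; apply: (eq_integrable _ _ _ _ (integrableB _ fi gi)). Qed.

Lemma intg_measurable f : intg f -> measurable_fun D f.
Proof. by move=> /integrableP[/measurable_EFinP]. Qed.

Lemma RintD f g : intg f -> intg g ->
  \int[mu]_(x in D) (f x + g x) =
  \int[mu]_(x in D) f x + \int[mu]_(x in D) g x.
Proof. by move=> fi gi; exact: RintegralD. Qed.

Lemma RintB f g : intg f -> intg g ->
  \int[mu]_(x in D) (f x - g x) =
  \int[mu]_(x in D) f x - \int[mu]_(x in D) g x.
Proof. by move=> fi gi; exact: RintegralB. Qed.

Lemma RintZ k f : intg f ->
  \int[mu]_(x in D) (k * f x) = k * \int[mu]_(x in D) f x.
Proof. by move=> fi; exact: RintegralZl. Qed.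

Lemma Rint_EFin f : intg f ->
  (\int[mu]_(x in D) f x)%:E = (\int[mu]_(x in D) (f x)%:E)%E.
Proof.
by move=> fi; rewrite /Rintegral fineK//; exact: integrable_fin_num.
Qed.

Lemma sqint_mul f g : sqint f -> sqint g -> intg (fun x => f x * g x).
Proof.
move=> [mf fi] [mg gi].
apply: (@intg_mono _ (fun x => f x ^+ 2 + g x ^+ 2)).
- exact: measurable_funM.
- exact: intgD.
- move=> x _; rewrite normrM -(real_normK (num_real (f x))).
  rewrite -(real_normK (num_real (g x))).
  have := sqr_ge0 (`|f x| - `|g x|); have := sqr_ge0 `|f x|.
  have := sqr_ge0 `|g x|; rewrite !expr2; nra.
Qed.

Lemma sqintZ k f : sqint f -> sqint (fun x => k * f x).
Proof.
move=> [mf fi]; split; first exact: measurable_funM.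
apply: (eq_integrable _ _ _ _ (intgZ (k ^+ 2) fi)) => // x _ /=.
by rewrite exprMn.
Qed.

Lemma sqintD f g : sqint f -> sqint g -> sqint (fun x => f x + g x).
Proof.
move=> sf sg; split; first by apply: measurable_funD; [case: sf|case: sg].
have h := intgD (intgD sf.2 sg.2) (intgZ 2 (sqint_mul sf sg)).
apply: (eq_integrable _ _ _ _ h) => // x _ /=.
by congr EFin; ring.
Qed.

Lemma sqintB f g : sqint f -> sqint g -> sqint (fun x => f x - g x).
Proof.
move=> sf sg; have := sqintD sf (sqintZ (-1) sg).
by under eq_fun do rewrite mulN1r.
Qed.

Lemma ipC f g : ip f g = ip g f.
Proof. by apply: eq_Rintegral => x _; rewrite mulrC. Qed.

Lemma ipDl f g h : sqint f -> sqint g -> sqint h ->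
  ip (fun x => f x + g x) h = ip f h + ip g h.
Proof.
move=> sf sg sh; rewrite /ip -RintD; [|exact: sqint_mul..].
by apply: eq_Rintegral => x _; rewrite mulrDl.
Qed.

Lemma ipZl k f h : sqint f -> sqint h ->
  ip (fun x => k * f x) h = k * ip f h.
Proof.
move=> sf sh; rewrite /ip -RintZ; last exact: sqint_mul.
by apply: eq_Rintegral => x _; rewrite mulrA.
Qed.

Lemma ipBl f g h : sqint f -> sqint g -> sqint h ->
  ip (fun x => f x - g x) h = ip f h - ip g h.
Proof.
move=> sf sg sh; rewrite /ip -RintB; [|exact: sqint_mul..].
by apply: eq_Rintegral => x _; rewrite mulrBl.
Qed.

Lemma ip_ge0 f : 0 <= ip f f.
Proof. by apply: Rintegral_ge0 => x _; rewrite -expr2 sqr_ge0. Qed.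

(** Discriminant argument: the squared norm of [f - t * g] is nonnegative for every real [t]. *)
Lemma ip_cauchy_schwarz f g : sqint f -> sqint g ->
  ip f g ^+ 2 <= ip f f * ip g g.
Proof.
move=> sf sg.
have key t : 0 <= ip f f - 2 * t * ip f g + t ^+ 2 * ip g g.
  have := ip_ge0 (fun x => f x - t * g x).
  rewrite ipBl//; [|exact: sqintZ|by apply: sqintB => //; exact: sqintZ].
  rewrite ipZl//; last by apply: sqintB => //; exact: sqintZ.
  rewrite (ipC f (fun x => _ - _)) (ipC g (fun x => _ - _)).
  rewrite !ipBl//; [|exact: sqintZ..].
  by rewrite !ipZl// (ipC g f) => h; apply: le_trans h _; lra.
have [g0|gn0] := eqVneq (ip g g) 0.
- rewrite g0 mulr0; have f0 := ip_ge0 f.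
  (* With [ip g g = 0] the expression is affine in [t]; this [t] would give it the value -1 unless
     [ip f g = 0]. *)
  have := key ((ip f f + 1) / (2 * ip f g)); rewrite g0 mulr0 addr0.
  have [->|fg0] := eqVneq (ip f g) 0; first by rewrite expr0n.
  have -> : 2 * ((ip f f + 1) / (2 * ip f g)) * ip f g = ip f f + 1 by field.
  by move=> h; exfalso; lra.
- have gp : 0 < ip g g by rewrite lt_neqAle eq_sym gn0 ip_ge0.
  (* The minimiser in [t] of the quadratic. *)
  have := key (ip f g / ip g g).
  have -> : ip f f - 2 * (ip f g / ip g g) * ip f g +
     (ip f g / ip g g) ^+ 2 * ip g g =
     (ip f f * ip g g - ip f g ^+ 2) / ip g g by field.
  by rewrite pmulr_lge0 ?invr_gt0// subr_ge0.
Qed.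

Lemma sqint_sum (p : nat -> R -> R) n : (forall k, sqint (p k)) ->
  sqint (fun x => \sum_(k < n) p k x).
Proof.
move=> sp; elim: n => [|n ih].
  have := sqintZ 0 (sp 0%N).
  by under eq_fun do rewrite mul0r; under [X in _ -> sqint X]eq_fun do rewrite big_ord0.
under eq_fun do rewrite big_ord_recr/=.
exact: sqintD.
Qed.

Lemma ip_suml (p : nat -> R -> R) n h : (forall k, sqint (p k)) -> sqint h ->
  ip (fun x => \sum_(k < n) p k x) h = \sum_(k < n) ip (p k) h.
Proof.
move=> sp sh; elim: n => [|n ih].
  rewrite [RHS]big_ord0 -[RHS](mul0r (ip (p 0%N) h)) -ipZl//.
  by congr ip; apply/funext => x; rewrite big_ord0 mul0r.
rewrite big_ord_recr/= -ih -ipDl//; last exact: sqint_sum.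
by congr ip; apply/funext => x; rewrite big_ord_recr.
Qed.

Lemma intg_bounded f (C : R) : measurable_fun D f ->
  (forall x, D x -> `|f x| <= C) -> intg f.
Proof.
move=> mf fC; apply: (@intg_mono _ (fun=> C)) => //.
apply/integrableP; split; first exact/measurable_EFinP.
rewrite (eq_integral (cst `|C|%:E))// integral_cst//.
by rewrite [X in (_ * X)%E]mu_circle -EFinM ltry.
Qed.

Lemma sqint_bounded f (C : R) : measurable_fun D f ->
  (forall x, D x -> `|f x| <= C) -> sqint f.
Proof.
move=> mf fC; split => //; apply: (@intg_bounded _ (C ^+ 2)).
  exact: measurable_funX.
move=> x Dx; rewrite normrX ler_sqr ?nnegrE//.
  exact: fC.
by rewrite (le_trans _ (fC _ Dx)).
Qed.

Lemma Rintegral_circle_cst (r : R) : \int[mu]_(x in D) r = r * (2 * pi).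
Proof.
rewrite /Rintegral (eq_integral (cst r%:E))// integral_cst//.
by rewrite [X in (_ * X)%E]mu_circle.
Qed.

Lemma within_continuous_bounded f : {within D, continuous f} ->
  exists C : R, forall x, D x -> `|f x| <= C.
Proof.
move=> cf.
have /continuous_compact : {within D, continuous f} by [].
move=> /(_ (@segment_compact _ _ _)) /compact_bounded [M [_ hM]].
exists (M + 1) => x Dx; apply: (hM (M + 1)); first by rewrite ltrDl.
by exists x.
Qed.

Lemma sqint_within_continuous f : {within D, continuous f} -> sqint f.
Proof.
move=> cf; have [C fC] := within_continuous_bounded cf.
apply: sqint_bounded fC; exact: subspace_continuous_measurable_fun.
Qed.

Lemma sqint_continuous f : continuous f -> sqint f.
Proof.
move=> cf; apply: sqint_within_continuous.
exact: continuous_subspaceT.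
Qed.

Lemma sqint_intg f : sqint f -> intg f.
Proof.
move=> sf; have := sqint_mul sf (sqint_continuous (@cst_continuous R R 1)).
by apply: eq_integrable => // x _ /=; rewrite mulr1.
Qed.

(** Bridge from the extension by zero used in the statement to [sqint], which speaks only of values
    on [D]; the later arguments are phrased with [sqint]. *)
Lemma L2_circleP f : L2_circle f <-> sqint f.
Proof.
have e : (fun x => (f \_ D) x ^+ 2) = (fun x => f x ^+ 2) \_ D.
  apply/funext => x; rewrite /patch; case: ifP => // _.
  by rewrite expr0n.
split=> [h|[mf fi]].
- have := Lfun2_integrable_sqr h.
  move: h; rewrite /L2_circle inE => /andP[/[!inE]/= mf _] i2; split.
    by apply/(measurable_restrictT _ _).
  apply/integrable_mkcond => //.
  by rewrite restrict_EFin -e.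
- rewrite /L2_circle inE; apply/andP; rewrite !inE/=; split.
    by apply: (measurable_restrictT _ _).1.
  rewrite /finite_norm unlock; apply: poweR_lty.
  have : mu.-integrable setT ((EFin \o (fun x => f x ^+ 2)) \_ D).
    by apply: (integrable_mkcond _ _).1.
  rewrite restrict_EFin -e => /integrableP[_].
  apply: le_lt_trans; apply: ge0_le_integral => //=.
  + apply/measurable_EFinP.
    apply/(@measurableT_comp _ _ _ _ _ _ (fun x : R => x `^ 2)) => //.
    by apply: measurableT_comp => //; apply: (measurable_restrictT _ _).1.
  + apply/measurable_EFinP; apply: measurableT_comp => //; apply: measurable_funX.
    by apply: (measurable_restrictT _ _).1.
  + by move=> x _; rewrite lee_fin powR_mulrn// normrX.
Qed.

Lemma L2norm_sqr f : sqint f -> L2norm f ^+ 2 = ip f f.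
Proof.
move=> [mf fi]; rewrite /L2norm.
have e2 : ('N[mu]_2%:E [EFin \o f \_ D] `^ 2 = (ip f f)%:E)%E.
  rewrite powR_Lnorm// /ip /Rintegral fineK.
    rewrite [RHS]integral_mkcond; apply: eq_integral => x _ /=.
    rewrite /patch; case: ifPn => _ /=.
      by rewrite powR_mulrn// real_normK ?num_real// expr2.
    by rewrite normr0 powR0.
  by apply: integrable_fin_num => //; exact: sqint_mul.
have n0 := Lnorm_ge0 mu 2%:E (EFin \o f \_ D).
have nf : ('N[mu]_2%:E [EFin \o f \_ D] \is a fin_num)%E.
  rewrite ge0_fin_numE//; apply: (@lty_poweRy _ _ 2) => //.
  by rewrite e2 ltry.
have : ((fine 'N[mu]_2%:E [EFin \o f \_ D])%:E `^ 2 = (ip f f)%:E)%E.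
  by rewrite fineK.
by rewrite poweR_EFin => -[<-]; rewrite powR_mulrn// fine_ge0.
Qed.

End square_integrable.

(** * The Riesz-Fischer theorem *)

Section riesz_fischer.
Context {R : realType}.
Notation mu := (@lebesgue_measure R).
Notation D := (@circle R).
Let measurable_D := @measurable_circle R.
Hint Resolve measurable_D : core.

Lemma measurable_fun_limn_einf (f : (R -> \bar R)^nat) (A : set R) :
  (forall n, measurable_fun A (f n)) ->
  measurable_fun A (fun x => limn_einf (f ^~ x)).
Proof.
move=> mf; rewrite /limn_einf; apply: measurableT_comp => //.
by apply: measurable_fun_limn_esup => n; apply: measurableT_comp.
Qed.

Lemma limn_einf_le_bound (u : (\bar R)^nat) (l : \bar R) :
  (forall n, (u n <= l)%E) -> (limn_einf u <= l)%E.
Proof.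
move=> ul; rewrite limn_einf_lim; apply: lime_le; first exact: is_cvg_einfs.
apply: nearW => n; apply: (@le_trans _ _ (u n)) => //.
by apply: ereal_inf_lbound; exists n => /=.
Qed.

Lemma cvg_sqr0 (u e : R^nat) : (forall n, u n ^+ 2 <= e n) ->
  e @ \oo --> (0:R) -> u @ \oo --> (0:R).
Proof.
move=> ue e0; apply/cvgr0Pnorm_lt => d d0.
have d20 : 0 < d ^+ 2 by rewrite exprn_gt0.
move/cvgr0Pnorm_lt : e0 => /(_ _ d20); apply: filterS => n en.
rewrite -ltr_sqr ?nnegrE ?normr_ge0 ?ltW//.
rewrite -[X in X < _](_ : u n ^+ 2 = _); last by rewrite real_normK ?num_real.
by rewrite (le_lt_trans (ue n))// (le_lt_trans (ler_norm _)).
Qed.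

(** AM-GM with a free weight [r], by completing the square. The weight turns a bound on squares into
    a summable bound on absolute values: it is 2^-j in [pointwise_limit] and k^-2 in
    [dirichlet_summable]. *)
Lemma weighted_abs_le (d r : R) : 0 < r -> `|d| <= (r + r^-1 * d ^+ 2) / 2.
Proof.
move=> r0; rewrite -(real_normK (num_real d)).
have := sqr_ge0 (r - `|d|); rewrite sqrrB => h.
have -> : (r + r^-1 * `|d| ^+ 2) / 2 =
  `|d| + (r ^+ 2 - r * `|d| *+ 2 + `|d| ^+ 2) / (2 * r).
  by field; rewrite gt_eqF.
by rewrite lerDl divr_ge0// mulr_ge0// ltW.
Qed.

Lemma intg_abs_le (d : R -> R) (r : R) : sqint d -> 0 < r ->
  (\int[mu]_(x in D) `|d x|%:E <=
   ((r * (2 * pi) + r^-1 * ip d d) / 2)%:E)%E.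
Proof.
move=> sd r0.
have -> : (r * (2 * pi) + r^-1 * ip d d) / 2 =
  \int[mu]_(x in D) (2^-1 * (r + r^-1 * (d x * d x))).
  have i1 : mu.-integrable D (EFin \o (fun=> r)).
    by apply: (@intg_bounded _ _ `|r|).
  have i2 := intgZ r^-1 (sqint_mul sd sd).
  rewrite RintZ; last exact: (intgD i1 i2).
  rewrite RintD// Rintegral_circle_cst RintZ; last exact: sqint_mul.
  by rewrite mulrC.
have i3 : mu.-integrable D (EFin \o (fun x => 2^-1 * (r + r^-1 * (d x * d x)))).
  have i1 : mu.-integrable D (EFin \o (fun=> r)).
    by apply: (@intg_bounded _ _ `|r|).
  exact: (intgZ 2^-1 (intgD i1 (intgZ r^-1 (sqint_mul sd sd)))).
rewrite Rint_EFin//.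
apply: ge0_le_integral => //.
- by apply/measurable_EFinP; apply: measurableT_comp => //; case: sd.
- by move/integrableP : i3 => [].
- by move=> x _; rewrite lee_fin -expr2 mulrC; exact: weighted_abs_le.
Qed.

Section orthogonal_sum.
Variables (p : nat -> R -> R).
Hypothesis sp : forall k, sqint (p k).
Hypothesis op : forall j k, j != k -> ip (p j) (p k) = 0.

Notation S n := (fun x => \sum_(k < n) p k x).
Notation s n := (\sum_(k < n) ip (p k) (p k)).

Lemma ip_orthogonal_sum n k :
  ip (S n) (p k) = if (k < n)%N then ip (p k) (p k) else 0.
Proof.
rewrite ip_suml//; case: ltnP => kn.
  rewrite (bigD1 (Ordinal kn))//= big1 ?addr0// => i ik.
  by apply: op; apply: contra_neq ik => ik; apply/val_inj.
by rewrite big1// => i _; apply: op; rewrite ltn_eqF// (leq_trans _ kn).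
Qed.

Lemma ip_orthogonal_sums n m : (n <= m)%N -> ip (S n) (S m) = s n.
Proof.
move=> nm; rewrite ip_suml//; last exact: sqint_sum.
apply: eq_bigr => i _; rewrite ipC ip_orthogonal_sum.
by rewrite (leq_trans (ltn_ord i) nm).
Qed.

Lemma ip_orthogonal_sumB n m : (n <= m)%N ->
  ip (fun x => S m x - S n x) (fun x => S m x - S n x) = s m - s n.
Proof.
move=> nm; have sS k : sqint (S k) := sqint_sum _ sp.
rewrite ipBl//; last exact: sqintB.
rewrite !(ipC _ (fun x => _ - _)) !ipBl//.
rewrite ip_orthogonal_sums// (ipC (S m) (S n)) ip_orthogonal_sums//.
by rewrite !ip_orthogonal_sums//; ring.
Qed.

Lemma orthogonal_sum_nd : nondecreasing_seq (fun n => s n).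
Proof.
apply/nondecreasing_seqP => n; rewrite big_ord_recr/= lerDl.
exact: ip_ge0.
Qed.

Variable C : R.
Hypothesis pC : forall n, s n <= C.

Let sigma := limn (fun n => s n).

Let cvg_s : (fun n => s n) @ \oo --> sigma.
Proof.
apply: nondecreasing_is_cvgn; first exact: orthogonal_sum_nd.
by exists C => _ [n _ <-].
Qed.

Let s_le n : s n <= sigma.
Proof. exact: (nondecreasing_cvgn_le orthogonal_sum_nd cvg_s). Qed.

(** The rate 4^-j bounds squared norms, so consecutive differences along [phi] have norm at most
    2^-j, which is summable. *)
Let subseq : exists phi : nat -> nat,
  [/\ {homo phi : i j / (i <= j)%N}, forall j, (j <= phi j)%N &
      forall j, sigma - s (phi j) <= 4^-1 ^+ j].
Proof.
have h j : exists n, forall m, (n <= m)%N -> sigma - s m <= 4^-1 ^+ j.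
  have e0 : 0 < 4^-1 ^+ j :> R by rewrite exprn_gt0// invr_gt0.
  move/cvgrPdist_le : cvg_s => /(_ _ e0)[n _ hn].
  by exists n => m nm; apply: le_trans (hn m nm); exact: ler_norm.
have [psi hpsi] := choice h.
(* Adding up the thresholds makes [phi] monotone and still at least [psi j]; the extra [j] forces
   [j <= phi j]. *)
exists (fun j => (\sum_(i < j.+1) psi i + j)%N); split.
- move=> i j ij; rewrite leq_add//.
  rewrite -(big_mkord xpredT psi) -(big_mkord xpredT psi).
  by rewrite (@big_cat_nat _ _ _ i.+1 0 j.+1)//= leq_addr.
- by move=> j; exact: leq_addl.
- move=> j; apply: hpsi; rewrite big_ord_recr/= -addnA (addnC (psi j)).
  by rewrite addnA leq_addl.
Qed.

Let sS n : sqint (S n). Proof. exact: sqint_sum. Qed.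

(** The L1 norms of consecutive differences are summable, so the sum [G] of their absolute values is
    integrable, hence finite almost everywhere, and the telescoping series converges absolutely
    there. *)
Let pointwise_limit (phi : nat -> nat) : {homo phi : i j / (i <= j)%N} ->
  (forall j, sigma - s (phi j) <= 4^-1 ^+ j) ->
  {ae mu, forall x, D x -> cvgn (fun j => S (phi j) x)}.
Proof.
move=> nphi hphi.
pose d j x := S (phi j.+1) x - S (phi j) x.
have sd j : sqint (d j) by exact: sqintB.
have dd j : ip (d j) (d j) <= 4^-1 ^+ j.
  rewrite ip_orthogonal_sumB; last exact: nphi.
  by apply: le_trans (hphi j); rewrite lerB.
have md j : measurable_fun D (fun x => `|d j x|%:E).
  by apply/measurable_EFinP; apply: measurableT_comp => //; case: (sd j).
pose G x := (\sum_(0 <= j <oo) `|d j x|%:E)%E.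
have iG : mu.-integrable D G.
  apply/integrableP; split.
    apply: (@emeasurable_fun_cvg _ _ _ _ (fun n x => \sum_(0 <= j < n) `|d j x|%:E)%E).
      by move=> n; apply: emeasurable_sum.
    move=> x _; apply: is_cvg_nneseries => n _ _; exact: lee_tofin.
  rewrite [ltLHS](_ : _ = (\int[mu]_(x in D) G x)%E); last first.
    apply: eq_integral => x _; rewrite gee0_abs//; apply: nneseries_ge0 => n _ _.
    by rewrite lee_fin.
  rewrite integral_nneseries//.
  apply: (@le_lt_trans _ _ (2 * (2 * pi + 1))%:E); last exact: ltry.
  apply: lime_le; first by apply: is_cvg_nneseries => n _ _; exact: integral_ge0.
  apply: nearW => n.
  apply: (@le_trans _ _ (\sum_(0 <= j < n) (2^-1 ^+ j * ((2 * pi + 1) / 2))%:E)%E).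
    apply: lee_sum => j _.
    (* The weight 2^-j balances the two terms, since 2^j 4^-j = 2^-j; each integral is at most 2^-j
       (2 pi + 1) / 2. *)
    have r0 : 0 < 2^-1 ^+ j :> R by rewrite exprn_gt0// invr_gt0.
    apply: (le_trans (intg_abs_le (sd j) r0)); rewrite lee_fin [leRHS]mulrA.
    rewrite ler_pM2r ?invr_gt0// [leRHS]mulrDr mulr1 lerD2l ler_pdivrMl//.
    apply: le_trans (dd j) _.
    by rewrite -exprMn -invfM -natrM.
  rewrite sumEFin lee_fin -mulr_suml.
  have -> : \sum_(0 <= j < n) 2^-1 ^+ j = 2 - 2 * 2^-1 ^+ n :> R.
    elim: n => [|n ih]; first by rewrite big_geq// expr0; ring.
    by rewrite big_nat_recr//= ih exprS; field.
  have h0 : 0 <= 2^-1 ^+ n :> R by rewrite exprn_ge0// invr_ge0.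
  have := pi_gt0 R; nra.
apply: ae_mono (integrable_ae _ iG) => // x /[apply] Gx.
have : cvgn (series (fun j => d j x)).
  apply: normed_cvg; apply: nondecreasing_is_cvgn.
    apply/nondecreasing_seqP => n; rewrite /= !seriesEnat/= big_nat_recr//=.
    by rewrite lerDl.
  exists (fine (G x)) => _ [n _ <-]; rewrite -lee_fin fineK// -sumEFin.
  have := @nneseries_lim_ge R (fun j => `|d j x|%:E) xpredT 0%N n.
  by apply => k _ _; rewrite lee_fin.
move=> cd; rewrite [X in cvgn X](_ : _ =
    (fun j => S (phi 0%N) x + series (fun j => d j x) j)).
  exact: is_cvgD (is_cvg_cst _) cd.
apply/funext => j.
by rewrite (eq_sum_telescope (fun j => S (phi j) x)).
Qed.

(** The limit is built pointwise along a subsequence. Fatou's lemma bounds its squared distance to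
    every partial sum by the tail of the energies, and Cauchy-Schwarz turns this into convergence of
    inner products for the whole sequence. *)
Theorem riesz_fischer : exists h, sqint h /\
  forall v, sqint v -> (fun n => ip (S n) v) @ \oo --> ip h v.
Proof.
have [phi [nphi lephi hphi]] := subseq.
have ae_cvg := pointwise_limit nphi hphi.
(* The upper limit is measurable on all of [D], whether or not the limit exists; [fine] supplies a
   default value only where it is infinite, a null set within [D]. *)
pose h x := fine (limn_esup (fun j => (S (phi j) x)%:E)).
have mS n : measurable_fun D (S n) by case: (sS n).
have mh : measurable_fun D h.
  apply: (@measurable_comp _ _ _ _ _ _ setT (@fine R)) => //.
  by apply: measurable_fun_limn_esup => n; exact/measurable_EFinP.
have {}ae_cvg : {ae mu, forall x, D x -> (fun j => S (phi j) x) @ \oo --> h x}.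
  apply: ae_mono ae_cvg => x /[apply] cx.
  suff -> : h x = limn (fun j => S (phi j) x) by [].
  rewrite /h; have /cvg_limn_einf_sup[_ ->//] :
    (S (phi j) x)%:E @[j --> \oo] --> (limn (fun j => S (phi j) x))%:E.
  by apply: cvg_EFin; [exact: nearW|exact: cx].
have key n : (\int[mu]_(x in D) ((h x - S n x) ^+ 2)%:E <= (sigma - s n)%:E)%E.
  (* The shift by [n] guarantees [n <= phi (j + n)], so the difference is a sum of orthogonal terms
     of index at least [n]. *)
  pose u j x := ((S (phi (j + n)%N) x - S n x) ^+ 2)%:E.
  have mu_ j : measurable_fun D (u j).
    apply/measurable_EFinP; apply: measurable_funX; exact: measurable_funB.
  have mhS : measurable_fun D (fun x => ((h x - S n x) ^+ 2)%:E).
    by apply/measurable_EFinP; apply: measurable_funX; exact: measurable_funB.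
  have mlim := measurable_fun_limn_einf mu_.
  rewrite [leLHS](_ : _ = (\int[mu]_(x in D) limn_einf (u ^~ x))%E); last first.
    apply: ae_eq_integral => //.
    apply: ae_mono ae_cvg => x /[apply] cx.
    suff /cvg_limn_einf_sup[-> _//] : u^~ x @ \oo --> ((h x - S n x) ^+ 2)%:E.
    apply: cvg_EFin; first exact: nearW.
    have c : S (phi (j + n)%N) x - S n x @[j --> \oo] --> h x - S n x.
      apply: cvgB; last exact: cvg_cst.
      by rewrite (cvg_shiftn n (fun j => S (phi j) x)).
    exact: (cvgM c c).
  apply: le_trans (fatou _ _ _ _) _ => //.
    by move=> j x _; rewrite lee_fin sqr_ge0.
  apply: limn_einf_le_bound => j.
  have nphij : (n <= phi (j + n))%N by rewrite (leq_trans _ (lephi _))// leq_addl.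
  rewrite [leLHS](_ : _ = (s (phi (j + n)%N) - s n)%:E).
    by rewrite lee_fin lerB.
  rewrite -ip_orthogonal_sumB// Rint_EFin; last by apply: sqint_mul; exact: sqintB.
  by apply: eq_integral => x _; rewrite /u expr2.
(* The empty sum being 0, [key] at 0 bounds the squared norm of [h] itself. *)
have sh : sqint h.
  split=> //; apply/integrableP; split.
    by apply/measurable_EFinP; exact: measurable_funX.
  apply: le_lt_trans (ltry (sigma - s 0%N)); apply: le_trans (key 0%N).
  rewrite le_eqVlt; apply/orP; left; apply/eqP; apply: eq_integral => x _.
  by rewrite big_ord0 subr0 /= ger0_norm ?sqr_ge0.
exists h; split=> // v sv.
have e0 : (fun n => (sigma - s n) * ip v v) @ \oo --> (0 : R).
  have := cvgMr_tmp (b := ip v v) (cvgB (cvg_cst sigma) cvg_s).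
  by rewrite subrr mul0r; apply.
apply/subr_cvg0; apply: cvg_sqr0 e0 => n.
have shS : sqint (fun x => h x - S n x) by exact: sqintB.
rewrite -sqrrN opprB -ipBl//; apply: le_trans (ip_cauchy_schwarz shS sv) _.
rewrite ler_wpM2r ?ip_ge0// -lee_fin; apply: le_trans (key n).
rewrite Rint_EFin; last exact: sqint_mul.
by rewrite le_eqVlt; apply/orP; left; apply/eqP; apply: eq_integral => x _; rewrite expr2.
Qed.

End orthogonal_sum.
End riesz_fischer.

(** * Uniqueness of Fourier coefficients *)

Section trigonometric_polynomials.
Context {R : realType}.
Notation mu := (@lebesgue_measure R).
Notation D := (@circle R).
Notation intg f := (mu.-integrable D (EFin \o f)).
Let measurable_D := @measurable_circle R.
Hint Resolve measurable_D : core.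

Lemma Rint_dominated (f_ : nat -> R -> R) (f g : R -> R) :
  (forall n, measurable_fun D (f_ n)) -> measurable_fun D f ->
  {ae mu, forall x, D x -> f_ ^~ x @ \oo --> f x} ->
  intg g -> (forall n x, D x -> `|f_ n x| <= g x) ->
  intg f /\ (fun n => \int[mu]_(x in D) f_ n x) @ \oo --> \int[mu]_(x in D) f x.
Proof.
move=> mf_ mf cf ig fg.
have mE (u : R -> R) : measurable_fun D u -> measurable_fun D (EFin \o u).
  by move=> mu_; exact/measurable_EFinP.
have ifn n : intg (f_ n) by exact: intg_mono (fg n).
have [||||| i1 _ i3] := @dominated_convergence _ _ _ mu D measurable_D
  (fun n x => (f_ n x)%:E) (fun x => (f x)%:E) (fun x => (g x)%:E).
- by move=> n; apply: mE.
- exact: mE.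
- apply: ae_mono cf => x /[apply] cx.
  by apply: cvg_EFin; [exact: nearW|exact: cx].
- exact: ig.
- by apply: aeW => x n Dx; rewrite lee_fin; exact: fg.
split; first exact: i1.
apply: fine_cvg; rewrite -[X in _ --> X]/((\int[mu]_(x in D) f x)%R%:E).
by rewrite Rint_EFin.
Qed.

Lemma ae_neq (a : R) : {ae mu, forall x, x != a}.
Proof.
exists [set a]; split => //; first exact: lebesgue_measure_set1.
by move=> x /= /negP; rewrite negbK => /eqP.
Qed.

Definition cosn (k : nat) (x : R) : R := cos (k%:R * x).
Definition sinn (k : nat) (x : R) : R := sin (k%:R * x).

(** The phase [a] makes one constructor cover cosines and sines and lets a wave be centred at any
    point; products stay in the class by the product-to-sum formula. *)
Inductive trig_poly : (R -> R) -> Prop :=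
| trig_poly_wave k a : trig_poly (fun x => cos (k%:R * x + a))
| trig_polyD u v : trig_poly u -> trig_poly v -> trig_poly (fun x => u x + v x)
| trig_polyZ c u : trig_poly u -> trig_poly (fun x => c * u x).

Lemma trig_poly_cst c : trig_poly (fun=> c).
Proof.
have := trig_polyZ c (trig_poly_wave 0 0).
by under eq_fun do rewrite mul0r add0r cos0 mulr1.
Qed.

Lemma trig_polyM u v : trig_poly u -> trig_poly v ->
  trig_poly (fun x => u x * v x).
Proof.
move=> tu; elim: tu v => [k a v tv|u1 u2 _ ih1 _ ih2 v tv|c u1 _ ih v tv].
- elim: tv => [l b|v1 v2 _ ih1 _ ih2|c v1 _ ih].
  (* Subtraction of frequencies is truncated, hence [l' <= k']; the other case follows by
     symmetry. *)
  + have wave_mul (k' l' : nat) (a' b' : R) : (l' <= k')%N ->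
      trig_poly (fun x => cos (k'%:R * x + a') * cos (l'%:R * x + b')).
      move=> lk; have := trig_polyZ 2^-1 (trig_polyD
        (trig_poly_wave (k' + l') (a' + b')) (trig_poly_wave (k' - l') (a' - b'))).
      congr trig_poly; apply/funext => x.
      have -> : (k' + l')%:R * x + (a' + b') =
        (k'%:R * x + a') + (l'%:R * x + b') by rewrite natrD; ring.
      have -> : (k' - l')%:R * x + (a' - b') =
        (k'%:R * x + a') - (l'%:R * x + b') by rewrite natrB//; ring.
      by rewrite cosD cosB; field.
    have [lk|/ltnW kl] := leqP l k; first exact: wave_mul.
    have := wave_mul l k b a kl.
    by congr trig_poly; apply/funext => x; rewrite mulrC.
  + have := trig_polyD ih1 ih2.
    by congr trig_poly; apply/funext => x; rewrite mulrDr.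
  + have := trig_polyZ c ih.
    by congr trig_poly; apply/funext => x; rewrite mulrCA.
- have := trig_polyD (ih1 _ tv) (ih2 _ tv).
  by congr trig_poly; apply/funext => x; rewrite mulrDl.
- have := trig_polyZ c (ih _ tv).
  by congr trig_poly; apply/funext => x; rewrite mulrA.
Qed.

Lemma trig_polyX u n : trig_poly u -> trig_poly (fun x => u x ^+ n).
Proof.
move=> tu; elim: n => [|n ih]; first exact: trig_poly_cst.
have := trig_polyM tu ih.
by congr trig_poly; apply/funext => x; rewrite exprS.
Qed.

Lemma continuous_wave (a b : R) : continuous (fun x : R => cos (a * x + b)).
Proof.
move=> x; apply: continuous_comp; last exact: continuous_cos.
by apply: cvgD; [apply: cvgMl_tmp; exact: cvg_id|exact: cvg_cst].
Qed.

Lemma trig_poly_continuous u : trig_poly u -> continuous u.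
Proof.
elim=> [k a|v w _ cv _ cw|c v _ cv] x.
- exact: continuous_wave.
- by apply: cvgD; [exact: cv|exact: cw].
- by apply: cvgMl_tmp; exact: cv.
Qed.

Lemma cosn_continuous k : continuous (cosn k).
Proof.
move=> x; have := @continuous_wave k%:R 0 x.
by under eq_fun do rewrite addr0.
Qed.

Lemma sinn_continuous k : continuous (sinn k).
Proof.
have -> : sinn k = (fun x => cos (k%:R * x + - (pi / 2))).
  by apply/funext => x; rewrite cosBpihalf.
by move=> x; exact: continuous_wave.
Qed.

Lemma sqint_cosn k : sqint (cosn k).
Proof. by apply: sqint_continuous; exact: cosn_continuous. Qed.

Lemma sqint_sinn k : sqint (sinn k).
Proof. by apply: sqint_continuous; exact: sinn_continuous. Qed.

Lemma trig_poly_sqint u : trig_poly u -> sqint u.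
Proof. by move=> tu; apply: sqint_continuous; exact: trig_poly_continuous. Qed.

Lemma bernoulli_ge (x : R) n : 0 <= x <= 1 -> 1 - n%:R * x <= (1 - x) ^+ n.
Proof.
move=> /andP[x0 x1]; elim: n => [|n ih]; first by rewrite mul0r subr0.
rewrite exprS -natr1.
have n0 : 0 <= n%:R :> R by [].
have : 0 <= (1 - x) * ((1 - x) ^+ n - (1 - n%:R * x)).
  by rewrite mulr_ge0// subr_ge0.
nra.
Qed.

Lemma bernoulli_le (x : R) n : 0 <= x <= 1 -> (1 - x) ^+ n * (1 + n%:R * x) <= 1.
Proof.
move=> /andP[x0 x1]; elim: n => [|n ih]; first by rewrite mul0r addr0 mulr1.
apply: le_trans ih; rewrite exprSr -mulrA ler_wpM2l ?exprn_ge0 ?subr_ge0//.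
rewrite -natr1; have n0 : 0 <= n%:R :> R by [].
have := mulr_ge0 n0 (sqr_ge0 x); have := sqr_ge0 x; rewrite !expr2; nra.
Qed.

(* The polynomials [(1 - x^n)^(2^n)] converge boundedly on [0, 1] to the
   indicator function of [0, 1/2[ (away from 1/2), by Bernoulli's inequality. *)
Definition step_poly n (x : R) := (1 - x ^+ n) ^+ (2 ^ n).

Lemma step_poly_itv n x : 0 <= x <= 1 -> 0 <= step_poly n x <= 1.
Proof.
move=> /andP[x0 x1].
have h : 0 <= 1 - x ^+ n <= 1.
  by rewrite subr_ge0 exprn_ile1// gerBl exprn_ge0.
by case/andP: h => h0 h1; rewrite exprn_ge0// exprn_ile1.
Qed.

Lemma step_poly_lt x : 0 <= x < 2^-1 -> step_poly ^~ x @ \oo --> (1 : R).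
Proof.
move=> /andP[x0 x2].
have x01 : 0 <= x <= 1 by rewrite x0/=; lra.
apply: (@squeeze_cvgr _ _ _ _ (fun n => 1 - (2 * x) ^+ n) (fun=> 1) _).
- apply: nearW => n; have /andP[_ ->] := step_poly_itv n x01; rewrite andbT.
  (* Bernoulli bounds the defect by 2^n x^n = (2 x)^n, whence the threshold 1/2. *)
  rewrite /step_poly; apply: le_trans (bernoulli_ge _ _); last first.
    by case/andP: x01 => ? ?; rewrite exprn_ge0// exprn_ile1.
  by rewrite exprMn natrX.
- rewrite -[X in _ --> X]subr0; apply: cvgB; first exact: cvg_cst.
  by apply: cvg_expr; rewrite ger0_norm; nra.
- exact: cvg_cst.
Qed.

Lemma step_poly_gt x : 2^-1 < x <= 1 -> step_poly ^~ x @ \oo --> (0 : R).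
Proof.
move=> /andP[x2 x1].
have x01 : 0 <= x <= 1 by rewrite x1 andbT; lra.
apply: (@squeeze_cvgr _ _ _ _ (fun=> 0) (fun n => ((2 * x)^-1) ^+ n) _).
- apply: nearW => n; have /andP[-> _] := step_poly_itv n x01; rewrite andTb.
  have xn : 0 <= x ^+ n <= 1.
    by case/andP: x01 => ? ?; rewrite exprn_ge0// exprn_ile1.
  have := bernoulli_le (2 ^ n) xn; rewrite natrX -exprMn -/(step_poly n x).
  have p0 : 0 < (2 * x) ^+ n by rewrite exprn_gt0//; lra.
  have s0 : 0 <= step_poly n x by case/andP: (step_poly_itv n x01).
  by move=> h; rewrite exprVn -[leRHS]mul1r ler_pdivlMr//; nra.
- exact: cvg_cst.
- apply: cvg_expr; rewrite ger0_norm; last by rewrite invr_ge0; lra.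
  by rewrite invf_lt1; lra.
Qed.

(** The bound [2 * pi - d] keeps [y] short of the next periodic image of [[- d, d]], which matters
    because [x - c] may leave [[- pi, pi]]. Beyond [pi], the reflection [2 * pi - y] returns to the
    decreasing branch of the cosine. *)
Lemma cos_lt_dist (d y : R) : 0 < d -> `|y| < 2 * pi - d ->
  ((`|y| < d) -> cos d < cos y) /\ (d < `|y| -> cos y < cos d).
Proof.
move=> d0 y2; rewrite -(cos_norm y).
have y0 := normr_ge0 y; move: `|y| y0 y2 => {}y y0 y2.
have dpi : d < 2 * pi by lra.
have mono (a b : R) : 0 <= a -> a < b -> b <= pi -> cos b < cos a.
  by move=> a0 ab bpi; rewrite ltr_cos// in_itv/=; lra.
have refl (a : R) : cos (2 * pi - a) = cos a.
  have -> : 2 * pi - a = - a + pi *+ 2 by rewrite -mulr_natl; ring.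
  by rewrite cosD2pi cosN.
split=> yd.
- have [dp|dp] := leP d pi; first exact: mono.
  by rewrite -(refl d); apply: mono; lra.
- have [yp|yp] := leP y pi; first by apply: mono; lra.
  by rewrite -(refl y); apply: mono; lra.
Qed.

Section uniqueness.
Variable f : R -> R.
Hypothesis sf : sqint f.
Hypothesis f_cos : forall k, ip f (cosn k) = 0.
Hypothesis f_sin : forall k, ip f (sinn k) = 0.

Lemma trig_poly_orthogonal u : trig_poly u -> ip f u = 0.
Proof.
elim=> [k a|v w tv fv tw fw|c v tv fv].
- have -> : (fun x => cos (k%:R * x + a)) =
      (fun x => cos a * cosn k x - sin a * sinn k x).
    by apply/funext => x; rewrite cosD /cosn /sinn; ring.
  have sc := sqintZ (cos a) (sqint_cosn k).
  have ss := sqintZ (sin a) (sqint_sinn k).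
  rewrite ipC ipBl// !ipZl//; [|exact: sqint_sinn|exact: sqint_cosn].
  by rewrite (ipC _ f) (ipC _ f) f_cos f_sin; ring.
- rewrite ipC ipDl//; [|exact: trig_poly_sqint..].
  by rewrite !(ipC _ f) fv fw addr0.
- rewrite ipC ipZl//; last exact: trig_poly_sqint.
  by rewrite (ipC _ f) fv mulr0.
Qed.

(** Composing [step_poly] with an affine function of [cos (x - c)] yields uniformly bounded
    trigonometric polynomials tending to the indicator of the ball; [f] is orthogonal to each of
    them, and dominated convergence passes to the limit. *)
Lemma orthogonal_ball (c d : R) : 0 < d -> - pi < c - d -> c + d < pi ->
  \int[mu]_(x in D) (f x * (`|x - c| < d)%R%:R) = 0.
Proof.
move=> d0 cd1 cd2.
(* A difference of cosines lies in [-2, 2], so the factor 1/4 keeps [v] in [0, 1]; [v x < 1/2]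
   exactly when [cos (x - c) > cos d]. *)
pose v x := 2^-1 - 4^-1 * (cos (x - c) - cos d).
have tv : trig_poly v.
  have := trig_polyD (trig_poly_cst (2^-1 + 4^-1 * cos d))
    (trig_polyZ (- 4^-1) (trig_poly_wave 1 (- c))).
  by congr trig_poly; apply/funext => x; rewrite /v mul1r; ring.
have v01 x : 0 <= v x <= 1.
  have := cos_le1 (x - c); have := cos_geN1 (x - c).
  by have := cos_le1 d; have := cos_geN1 d; rewrite /v; lra.
pose T n x := step_poly n (v x).
have tT n : trig_poly (T n).
  apply: trig_polyX; have := trig_polyD (trig_poly_cst 1)
    (trig_polyZ (-1) (trig_polyX n tv)).
  by congr trig_poly; apply/funext => x; rewrite mulN1r.
have mT n : measurable_fun D (T n) by case: (trig_poly_sqint (tT n)).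
have mind : measurable_fun D (fun x => (`|x - c| < d)%R%:R : R).
  have -> : (fun x => (`|x - c| < d)%R%:R : R) = \1_(ball c d).
    apply/funext => x; rewrite indicE; congr (_%:R).
    by congr nat_of_bool; apply/idP/idP; rewrite inE /ball/= distrC.
  apply: measurable_indic; exact: measurable_ball.
have [|||||_ h] := @Rint_dominated (fun n x => f x * T n x)
  (fun x => f x * (`|x - c| < d)%R%:R) (fun x => `|f x|).
- by move=> n; apply: measurable_funM => //; case: sf.
- by apply: measurable_funM => //; case: sf.
(* At [c + d] and [c - d] the value of [v] is 1/2, where the limit of [step_poly] is not
   controlled. *)
- apply: ae_mono (ae_and (ae_neq (c + d)) (ae_neq (c - d))) => x [xcd1 xcd2] Dx.
  apply: cvgMl_tmp; rewrite /T.
  have xD : `|x - c| < 2 * pi - d.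
    by move: Dx; rewrite /circle/= in_itv/= ltr_norml => /andP[? ?]; lra.
  have [lt gt] := cos_lt_dist d0 xD.
  have [xd|dx|xd] := ltgtP `|x - c| d.
  + apply: step_poly_lt; have := lt xd; have /andP[-> _] := v01 x.
    by rewrite /v; lra.
  + apply: step_poly_gt; have := gt dx; have /andP[_ ->] := v01 x.
    by rewrite /v; lra.
  + exfalso; move: xd; have [xc|xc] := leP 0 (x - c).
      by rewrite ger0_norm// => xd; move/eqP: xcd1; apply; lra.
    by rewrite ltr0_norm// => xd; move/eqP: xcd2; apply; lra.
- have := integrable_norm (sqint_intg sf); exact.
- move=> n x Dx; rewrite normrM ler_piMr// ger0_norm.
    by case/andP: (step_poly_itv n (v01 x)).
  by case/andP: (step_poly_itv n (v01 x)).
have h0 : (fun n => \int[mu]_(x in D) (f x * T n x)) = (fun=> 0).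
  by apply/funext => n; exact: trig_poly_orthogonal.
move: h; rewrite h0 => h; apply/esym.
by apply: (cvg_unique _ (@cvg_cst _ _ _ _ _) h).
Qed.

(** At a Lebesgue point [x], the mean of [f] over a small ball is 0 by [orthogonal_ball], so the
    mean of |f y - f x| is at least |f x|; as that mean tends to 0, so does the constant |f x|. *)
Theorem trig_uniqueness : {ae mu, forall x, D x -> f x = 0}.
Proof.
pose f0 := f \_ D.
have if0 : mu.-integrable setT (EFin \o f0).
  rewrite /f0 -restrict_EFin; apply: (integrable_mkcond _ _).1 => //.
  exact: sqint_intg.
have loc := open_integrable_locally openT if0.
apply: ae_mono (ae_and (ae_and (ae_neq pi) (ae_neq (- pi)))
  (lebesgue_differentiation loc)) => x [[x1 x2] xl] Dx.
have f0x : f0 x = f x by rewrite /f0 patchE mem_set.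
have {x1 x2} [x1 x2] : - pi < x /\ x < pi.
  by move: Dx; rewrite /circle/= in_itv/= !lt_neqAle (eq_sym _ x) x1 x2 => /andP[].
suff : (`|f x|%:E <= 0)%E by rewrite lee_fin normr_le0 => /eqP.
apply: (cvge_ge _ xl).
(* The ball around [x] must fit inside the open interval. *)
have e0 : 0 < Num.min (x + pi) (pi - x) by rewrite lt_min; apply/andP; lra.
near=> r.
have r0 : 0 < r by near: r; exact: nbhs_right_gt.
have rd : r < Num.min (x + pi) (pi - x) by near: r; exact: nbhs_right_lt.
have {rd} [rd1 rd2] : - pi < x - r /\ x + r < pi.
  by move: rd; rewrite lt_min => /andP[]; lra.
rewrite /davg /iavg.
have mB : measurable (ball x r) by exact: measurable_ball.
have iB : mu.-integrable (ball x r) (EFin \o f0) by exact: integrableS if0.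
have muB : mu (ball x r) = (r *+ 2)%:E by rewrite lebesgue_measure_ball// ltW.
have int0 : \int[mu]_(y in ball x r) f0 y = 0.
  rewrite -[RHS](orthogonal_ball r0 rd1 rd2) Rintegral_mkcond.
  rewrite [RHS]Rintegral_mkcond; apply: eq_Rintegral => y _.
  rewrite /f0 !patchE; case: ifPn => [|yB].
    rewrite inE => yB; case: ifPn => // _.
    by move: yB; rewrite /ball/= distrC => ->; rewrite mulr1.
  case: ifPn => // _; move: yB; rewrite notin_setE /ball/= distrC => /negP/negbTE ->.
  by rewrite mulr0.
rewrite [X in (X^-1 * _)%E]muB.
have ic : mu.-integrable (ball x r) (EFin \o (fun=> f0 x)).
  apply/integrableP; split; first exact/measurable_EFinP.
  rewrite [ltLHS](_ : _ = (\int[mu]_(y in ball x r) cst `|f0 x|%:E y)%E)//.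
  by rewrite integral_cst// [X in (_ * X)%E]muB -EFinM ltry.
have : (`|\int[mu]_(y in ball x r) (f0 y - f0 x)|%:E <=
   \int[mu]_(y in ball x r) `|(f0 y - f0 x)%:E|)%E.
  have ib : mu.-integrable (ball x r) (EFin \o (fun y => f0 y - f0 x)).
    by apply: (eq_integrable _ _ _ _ (integrableB _ iB ic)).
  rewrite EFin_normr_Rintegral//; apply: le_abse_integral => //.
  by case/integrableP: ib.
rewrite RintegralB// int0 sub0r normrN /Rintegral.
rewrite [X in fine X](_ : _ = (\int[mu]_(y in ball x r) cst (f0 x)%:E y)%E)//.
rewrite integral_cst// [X in fine (_ * X)]muB -EFinM/= normrM f0x => h.
have r20 : 0 < r *+ 2 by rewrite pmulrn_rgt0.
have : (`|f x|%:E <= ((r *+ 2)^-1)%:E * (`|f x| * `|r *+ 2|)%:E)%E.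
  by rewrite -EFinM lee_fin (gtr0_norm r20) mulrCA mulVf ?mulr1// gt_eqF.
move=> /le_trans; apply; rewrite inver gt_eqF//.
by apply: lee_pmul => //; rewrite lee_fin ?invr_ge0 ?mulr_ge0// ltW.
Unshelve. all: by end_near. Qed.

End uniqueness.
End trigonometric_polynomials.

(** * Parseval's identity *)

Section calculus.
Context {R : realType}.
Notation mu := (@lebesgue_measure R).
Notation D := (@circle R).
Let measurable_D := @measurable_circle R.
Hint Resolve measurable_D : core.
Implicit Types (f g F : R -> R) (x : R).

Lemma is_derive_addf x f g df dg : is_derive x 1 f df -> is_derive x 1 g dg ->
  is_derive x 1 (fun y => f y + g y) (df + dg).
Proof. by move=> h1 h2; exact: is_deriveD. Qed.

Lemma is_derive_mulf x f g df dg : is_derive x 1 f df -> is_derive x 1 g dg ->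
  is_derive x 1 (fun y => f y * g y) (df * g x + f x * dg).
Proof.
move=> h1 h2; apply: (is_derive_eq (is_deriveM h1 h2)).
by rewrite /GRing.scale/=; ring.
Qed.

Lemma is_derive_scalef x f df (c : R) : is_derive x 1 f df ->
  is_derive x 1 (fun y => c * f y) (c * df).
Proof.
move=> h; apply: (is_derive_eq (is_derive_mulf (is_derive_cst c x 1) h)).
by rewrite mul0r add0r.
Qed.

Lemma is_derive_affine x (a b : R) : is_derive x 1 (fun y => a * y + b) a.
Proof.
apply: (is_derive_eq (is_derive_addf
  (is_derive_scalef a (is_derive_id x 1)) (is_derive_cst b x 1))).
by rewrite mulr1 addr0.
Qed.

Lemma is_derive_comp_affine x f df (a b : R) : is_derive (a * x + b) 1 f df ->
  is_derive x 1 (fun y => f (a * y + b)) (a * df).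
Proof.
move=> h; apply: (is_derive_eq (is_derive1_comp _ (is_derive_affine x a b))).
by rewrite mulrC.
Qed.

Lemma is_derive_continuous f (df : R -> R) :
  (forall x, is_derive x 1 f (df x)) -> continuous f.
Proof.
move=> h x; apply/differentiable_continuous/derivable1_diffP.
by have [] := h x.
Qed.

Lemma circle_FTC2 F f : (forall x, is_derive x 1 F (f x)) ->
  {within D, continuous f} -> \int[mu]_(x in D) f x = F pi - F (- pi).
Proof.
move=> dF cf; have cF := is_derive_continuous dF.
rewrite /Rintegral (@continuous_FTC2 R f F)//.
- exact: circle_lt.
- split=> [x _||]; first by have [] := dF x.
  + by apply: cvg_at_right_filter; exact: cF.
  + by apply: cvg_at_left_filter; exact: cF.
- by move=> x _; rewrite derive1E; have [_ ->] := dF x.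
Qed.

Lemma is_derive_cosn k x : is_derive x 1 (cosn k) (- (k%:R * sinn k x)).
Proof.
have -> : cosn k = (fun y : R => cos (k%:R * y + 0)).
  by apply/funext => y; rewrite addr0.
apply: (is_derive_eq (is_derive_comp_affine (is_derive_cos _))).
by rewrite addr0 mulrN.
Qed.

Lemma is_derive_sinn k x : is_derive x 1 (sinn k) (k%:R * cosn k x).
Proof.
have -> : sinn k = (fun y : R => sin (k%:R * y + 0)).
  by apply/funext => y; rewrite addr0.
apply: (is_derive_eq (is_derive_comp_affine (is_derive_sin _))).
by rewrite addr0.
Qed.

Lemma sinn_pi k : sinn k (pi : R) = 0.
Proof.
rewrite /sinn; elim: k => [|k ih]; first by rewrite mul0r sin0.
by rewrite -natr1 mulrDl mul1r sinDpi ih oppr0.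
Qed.

Lemma cosnN k x : cosn k (- x) = cosn k x.
Proof. by rewrite /cosn mulrN cosN. Qed.

Lemma sinnN k x : sinn k (- x) = - sinn k x.
Proof. by rewrite /sinn mulrN sinN. Qed.

Lemma Rintegral_cosn k : \int[mu]_(x in D) cosn k x = (k == 0%N)%:R * (2 * pi).
Proof.
case: k => [|k].
  rewrite -Rintegral_circle_cst.
  by apply: eq_Rintegral => x _; rewrite /cosn mul0r cos0.
have dF x : is_derive x 1 (fun y => k.+1%:R^-1 * sinn k.+1 y) (cosn k.+1 x).
  apply: (is_derive_eq (is_derive_scalef _ (is_derive_sinn _ _))).
  by rewrite mulrA mulVf ?mul1r// pnatr_eq0.
rewrite mul0r (circle_FTC2 dF); first by rewrite sinnN sinn_pi oppr0 subrr.
exact/continuous_subspaceT/cosn_continuous.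
Qed.

Lemma Rintegral_sinn k : \int[mu]_(x in D) sinn k x = 0.
Proof.
case: k => [|k].
  rewrite -(mul0r (2 * pi)) -Rintegral_circle_cst.
  by apply: eq_Rintegral => x _; rewrite /sinn mul0r sin0.
have dF x : is_derive x 1 (fun y => - k.+1%:R^-1 * cosn k.+1 y) (sinn k.+1 x).
  apply: (is_derive_eq (is_derive_scalef _ (is_derive_cosn _ _))).
  by rewrite mulrNN mulrA mulVf ?mul1r// pnatr_eq0.
rewrite (circle_FTC2 dF); first by rewrite cosnN subrr.
exact/continuous_subspaceT/sinn_continuous.
Qed.

Lemma intg_cosn k : mu.-integrable D (EFin \o cosn k).
Proof. exact: sqint_intg (sqint_cosn k). Qed.

Lemma intg_sinn k : mu.-integrable D (EFin \o sinn k).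
Proof. exact: sqint_intg (sqint_sinn k). Qed.

(* [trig_norm k] is the squared norm of [cosn k], and also of [sinn k] for
   [k > 0]; note that [sinn 0 = 0]. *)
Definition trig_norm (k : nat) : R := if k == 0%N then 2 * pi else pi.

Lemma trig_norm_gt0 k : 0 < trig_norm k.
Proof. by rewrite /trig_norm; have := pi_gt0 R; case: ifP => _; lra. Qed.

Lemma ip_cosn_cosn k l : ip (cosn k) (cosn l) = (k == l)%:R * trig_norm k.
Proof.
(* Frequencies are ordered because [k - l] is truncated. *)
wlog lk : k l / (l <= k)%N.
  move=> h; have [/h//|/ltnW/h] := leqP l k.
  by rewrite ipC => ->; rewrite eq_sym; case: eqP => [->//|_]; rewrite !mul0r.
rewrite /ip [LHS](_ : _ = \int[mu]_(x in D)
    (2^-1 * (cosn (k + l) x + cosn (k - l) x))); last first.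
  apply: eq_Rintegral => x _.
  rewrite /cosn (natrB _ lk) natrD (mulrDl k%:R l%:R) (mulrBl x k%:R).
  by rewrite cosD cosB; field.
have i1 := intg_cosn (k + l); have i2 := intg_cosn (k - l).
rewrite RintZ; last exact: intgD.
(* For k = l = 0 both [k + l] and [k - l] vanish and both terms contribute, which is why
   [trig_norm 0] is twice the other values. *)
rewrite RintD// !Rintegral_cosn subn_eq0 addn_eq0 /trig_norm.
have [->|kl] := eqVneq k l.
  by rewrite leqnn andbb; case: eqP => _; rewrite ?mul1r ?mul0r; field.
have -> : (k <= l)%N = false.
  by apply/negP => h; move/eqP: kl; apply; apply/eqP; rewrite eqn_leq h.
case: eqP => [k0|_]; last by rewrite !mul0r addr0 mulr0.
by move: lk kl; rewrite k0 leqn0 eq_sym => ->.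
Qed.

Lemma ip_sinn_sinn k l :
  ip (sinn k) (sinn l) = ((k == l) && (k != 0%N))%:R * trig_norm k.
Proof.
wlog lk : k l / (l <= k)%N.
  move=> h; have [/h//|/ltnW/h] := leqP l k.
  by rewrite ipC => ->; rewrite eq_sym; case: eqP => [->//|_]; rewrite !mul0r.
rewrite /ip [LHS](_ : _ = \int[mu]_(x in D)
    (2^-1 * (cosn (k - l) x - cosn (k + l) x))); last first.
  apply: eq_Rintegral => x _.
  rewrite /cosn /sinn (natrB _ lk) natrD (mulrDl k%:R l%:R) (mulrBl x k%:R).
  by rewrite cosB cosD; field.
have i1 := intg_cosn (k + l); have i2 := intg_cosn (k - l).
rewrite RintZ; last by exact: intgB.
rewrite RintB// !Rintegral_cosn subn_eq0 addn_eq0 /trig_norm.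
have [->|kl] := eqVneq k l.
  by rewrite leqnn andbb; case: eqP => _; rewrite ?mul1r ?mul0r; field.
have -> : (k <= l)%N = false.
  by apply/negP => h; move/eqP: kl; apply; apply/eqP; rewrite eqn_leq h.
case: eqP => [k0|_]; last by rewrite !mul0r subr0 mulr0.
by move: lk kl; rewrite k0 leqn0 eq_sym => ->.
Qed.

Lemma ip_cosn_sinn k l : ip (cosn k) (sinn l) = 0 :> R.
Proof.
have h m n : (n <= m)%N ->
   \int[mu]_(x in D) (2^-1 * (sinn (m + n) x + sinn (m - n) x)) = 0 /\
   \int[mu]_(x in D) (2^-1 * (sinn (m + n) x - sinn (m - n) x)) = 0.
  move=> nm; have i1 := intg_sinn (m + n); have i2 := intg_sinn (m - n).
  split.
    by rewrite RintZ; [rewrite RintD// !Rintegral_sinn addr0 mulr0|exact: intgD].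
  by rewrite RintZ; [rewrite RintB// !Rintegral_sinn subr0 mulr0|exact: intgB].
have [lk|/ltnW kl] := leqP l k.
- rewrite -[RHS](h k l lk).2; apply: eq_Rintegral => x _.
  rewrite /cosn /sinn (natrB _ lk) natrD (mulrDl k%:R l%:R) (mulrBl x k%:R).
  by rewrite sinD sinB; field.
- rewrite -[RHS](h l k kl).1; apply: eq_Rintegral => x _.
  rewrite /cosn /sinn (natrB _ kl) natrD (mulrDl l%:R k%:R) (mulrBl x l%:R).
  by rewrite sinD sinB; field.
Qed.

Lemma ip_ae_eq f g u : measurable_fun D f -> measurable_fun D g ->
  measurable_fun D u -> {ae mu, forall x, D x -> f x = g x} ->
  ip f u = ip g u.
Proof.
move=> mf mg mu_ fg; congr fine; apply: ae_eq_integral => //.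
- by apply/measurable_EFinP; exact: measurable_funM.
- by apply/measurable_EFinP; exact: measurable_funM.
- by apply: ae_mono fg => x /[apply] ->.
Qed.

End calculus.

(** * Trigonometric series with square-summable coefficients, and Parseval *)

Section fourier.
Context {R : realType}.
Notation mu := (@lebesgue_measure R).
Notation D := (@circle R).
Let measurable_D := @measurable_circle R.
Hint Resolve measurable_D : core.

Definition trig_block (c d : nat -> R) (k : nat) (x : R) :=
  c k * cosn k x + d k * sinn k x.

Lemma sqint_trig_block c d k : sqint (trig_block c d k).
Proof.
by apply: sqintD; apply: sqintZ; [exact: sqint_cosn|exact: sqint_sinn].
Qed.

Lemma ip_trig_block c d k u : sqint u ->
  ip (trig_block c d k) u = c k * ip (cosn k) u + d k * ip (sinn k) u.
Proof.
move=> su; have sc := sqint_cosn k; have ss := sqint_sinn k.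
by rewrite ipDl ?ipZl//; exact: sqintZ.
Qed.

Section blocks.
Variables c d : nat -> R.
Hypothesis d0 : d 0%N = 0.

Lemma ip_trig_block_cosn k l :
  ip (trig_block c d k) (cosn l) = (k == l)%:R * (c k * trig_norm k).
Proof.
rewrite ip_trig_block; last exact: sqint_cosn.
by rewrite ip_cosn_cosn (ipC (sinn k)) ip_cosn_sinn; ring.
Qed.

(** The hypothesis [d 0 = 0] matters when k = l = 0: [sinn 0] is the zero function, while
    [trig_norm 0] is positive. *)
Lemma ip_trig_block_sinn k l :
  ip (trig_block c d k) (sinn l) = (k == l)%:R * (d k * trig_norm k).
Proof.
rewrite ip_trig_block; last exact: sqint_sinn.
rewrite ip_cosn_sinn ip_sinn_sinn.
by case: k => [|k]; rewrite ?d0 ?andbT; ring.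
Qed.

Lemma ip_trig_blocks k l : ip (trig_block c d k) (trig_block c d l) =
  (k == l)%:R * ((c k ^+ 2 + d k ^+ 2) * trig_norm k).
Proof.
rewrite ipC ip_trig_block; last exact: sqint_trig_block.
rewrite !(ipC _ (trig_block c d k)) ip_trig_block_cosn ip_trig_block_sinn.
by have [->|_] := eqVneq k l; rewrite ?mul1r ?mul0r; ring.
Qed.

(** Distinct blocks are orthogonal, so [riesz_fischer] applies. The coefficients of the limit can be
    read off because the inner product of a partial sum with [cosn l] or [sinn l] is constant once n
    exceeds l. *)
Theorem trig_series_converges (C : R) :
  (forall n, \sum_(k < n) (c k ^+ 2 + d k ^+ 2) * trig_norm k <= C) ->
  exists h, [/\ sqint h,
    (forall k, ip h (cosn k) = c k * trig_norm k /\
               ip h (sinn k) = d k * trig_norm k),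
    (forall v, sqint v ->
      (fun n => ip (fun x => \sum_(k < n) trig_block c d k x) v) @ \oo --> ip h v) &
    (fun n => \sum_(k < n) (c k ^+ 2 + d k ^+ 2) * trig_norm k) @ \oo --> ip h h].
Proof.
move=> hC.
have blkE n : \sum_(k < n) ip (trig_block c d k) (trig_block c d k) =
    \sum_(k < n) (c k ^+ 2 + d k ^+ 2) * trig_norm k.
  by apply: eq_bigr => k _; rewrite ip_trig_blocks eqxx mul1r.
have [||h [sh hw]] := @riesz_fischer R (trig_block c d) (sqint_trig_block c d) _ C.
- by move=> j k jk; rewrite ip_trig_blocks (negbTE jk) mul0r.
- by move=> n; rewrite blkE.
have coef (v : R -> R) (l : nat) (e : R) : sqint v ->
    (forall k, ip (trig_block c d k) v = (k == l)%:R * e) -> ip h v = e.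
  move=> sv hv; apply: (cvg_unique _ (hw v sv)); first exact: Rhausdorff.
  apply: cvg_near_cst; exists l.+1 => // n /= ln.
  rewrite ip_suml//; last exact: sqint_trig_block.
  rewrite (bigD1 (Ordinal ln))//= hv eqxx mul1r big1 ?addr0// => i il.
  by rewrite hv (_ : (i == l :> nat) = false) ?mul0r//; apply/negbTE.
have hc k : ip h (cosn k) = c k * trig_norm k.
  apply: (coef _ k); first exact: sqint_cosn.
  by move=> j; rewrite ip_trig_block_cosn; case: eqP => [->|]//; rewrite !mul0r.
have hd k : ip h (sinn k) = d k * trig_norm k.
  apply: (coef _ k); first exact: sqint_sinn.
  by move=> j; rewrite ip_trig_block_sinn; case: eqP => [->|]//; rewrite !mul0r.
exists h; split => //.
(* Testing the weak convergence against [h] itself gives its squared norm. *)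
rewrite [X in X @ _](_ : _ = (fun n => ip (fun x => \sum_(k < n) trig_block c d k x) h)).
  exact: hw.
apply/funext => n; rewrite ip_suml//; last exact: sqint_trig_block.
apply: eq_bigr => k _; rewrite ip_trig_block// (ipC _ h) (ipC _ h) hc hd.
by ring.
Qed.

End blocks.

Section parseval.
Variable f : R -> R.
Hypothesis sf : sqint f.

Definition fourier_cos k := ip f (cosn k) / trig_norm k.
Definition fourier_sin k := ip f (sinn k) / trig_norm k.

(* The squared norm of the projection of f onto the span of
   [cosn k] and [sinn k]. *)
Definition fourier_energy (k : nat) :=
  (ip f (cosn k) ^+ 2 + ip f (sinn k) ^+ 2) / trig_norm k.

Lemma ip_sinn0 : ip f (sinn 0) = 0.
Proof.
rewrite /ip -(mul0r (2 * pi)) -Rintegral_circle_cst.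
by apply: eq_Rintegral => x _; rewrite /sinn mul0r sin0 mulr0.
Qed.

Lemma fourier_energy_ge0 k : 0 <= fourier_energy k.
Proof.
by rewrite divr_ge0 ?(ltW (trig_norm_gt0 _))// addr_ge0 ?sqr_ge0.
Qed.

Let tn0 k : trig_norm k != 0 :> R. Proof. by rewrite gt_eqF// trig_norm_gt0. Qed.

Let fs0 : fourier_sin 0 = 0. Proof. by rewrite /fourier_sin ip_sinn0 mul0r. Qed.

Let S n := fun x => \sum_(k < n) trig_block fourier_cos fourier_sin k x.

Let energyE k : (fourier_cos k ^+ 2 + fourier_sin k ^+ 2) * trig_norm k =
  fourier_energy k.
Proof.
by rewrite /fourier_cos /fourier_sin /fourier_energy; field; exact: tn0.
Qed.

Lemma bessel n : \sum_(k < n) fourier_energy k <= ip f f.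
Proof.
have sS : sqint (S n) by apply: sqint_sum => k; exact: sqint_trig_block.
have := ip_ge0 (fun x => f x - S n x).
have sfS := sqintB sf sS.
rewrite ipBl// (ipC f) (ipC (S n)) !ipBl//.
have fS : ip (S n) f = \sum_(k < n) fourier_energy k.
  rewrite ip_suml//; last exact: sqint_trig_block.
  apply: eq_bigr => k _; rewrite ip_trig_block// !(ipC _ f).
  by rewrite /fourier_cos /fourier_sin /fourier_energy; field; exact: tn0.
have SS : ip (S n) (S n) = \sum_(k < n) fourier_energy k.
  rewrite ip_orthogonal_sums//; last 2 first.
  - exact: sqint_trig_block.
  - by move=> j k jk; rewrite ip_trig_blocks// (negbTE jk) mul0r.
  by apply: eq_bigr => k _; rewrite ip_trig_blocks// eqxx mul1r.
by rewrite (ipC f) fS SS subrr subr0 subr_ge0.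
Qed.

(** By Bessel the Fourier series of [f] has a sum [h]. The difference [f - h] has zero coefficients,
    so [h = f] almost everywhere by [trig_uniqueness], and the squared norm of [h] is already
    known. *)
Theorem parseval : (fun n => \sum_(k < n) fourier_energy k) @ \oo --> ip f f.
Proof.
have [|h [sh hc _ hh]] := @trig_series_converges fourier_cos fourier_sin fs0 (ip f f).
  by move=> n; under eq_bigr do rewrite energyE; exact: bessel.
have fh : {ae mu, forall x, D x -> f x - h x = 0}.
  apply: trig_uniqueness; first exact: sqintB.
  - move=> k; rewrite ipBl//; last exact: sqint_cosn.
    by rewrite (hc k).1 /fourier_cos divfK ?subrr.
  - move=> k; rewrite ipBl//; last exact: sqint_sinn.
    by rewrite (hc k).2 /fourier_sin divfK ?subrr.
have {}fh : {ae mu, forall x, D x -> h x = f x}.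
  by apply: ae_mono fh => x /[apply] /eqP; rewrite subr_eq0 => /eqP.
have -> : ip f f = ip h h.
  rewrite -(@ip_ae_eq _ h f f)//; [|by case: sh|by case: sf|by case: sf].
  by rewrite ipC -(@ip_ae_eq _ h f h)//; [case: sh|case: sf|case: sh].
by move: hh; under eq_fun do (under eq_bigr do rewrite energyE).
Qed.

End parseval.
End fourier.

(** * The heat form as a Fourier series *)

Section heat.
Context {R : realType}.
Notation mu := (@lebesgue_measure R).
Notation D := (@circle R).
Notation intg f := (mu.-integrable D (EFin \o f)).
Let measurable_D := @measurable_circle R.
Hint Resolve measurable_D : core.

Lemma le_norm_Rint (f g : R -> R) : intg f -> intg g ->
  (forall x, D x -> `|f x| <= g x) ->
  `|\int[mu]_(x in D) f x| <= \int[mu]_(x in D) g x.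
Proof.
move=> fi gi fg; apply: le_trans (le_normr_Rintegral _ fi) _ => //.
apply: le_Rintegral => //; exact: (integrable_norm fi).
Qed.

Definition gauss (t : R) (k : nat) : R := expR (- (k%:R ^+ 2 * t)).

Lemma gauss_gt0 t k : 0 < gauss t k.
Proof. exact: expR_gt0. Qed.

Lemma gauss0 t : gauss t 0 = 1.
Proof. by rewrite /gauss expr0n mul0r oppr0 expR0. Qed.

Lemma gauss_le_geometric t k : 0 < t -> gauss t k <= expR (- t) ^+ k.
Proof.
move=> t0; rewrite -expRM_natl ler_expR mulrN lerN2 ler_wpM2r ?(ltW t0)//.
case: k => [|k]; first by rewrite expr0n.
by rewrite expr2 ler_peMl// ler1n.
Qed.

Lemma gauss_le1 t k : 0 < t -> gauss t k <= 1.
Proof.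
move=> t0; apply: le_trans (gauss_le_geometric k t0) _.
by rewrite exprn_ile1 ?expR_ge0// expR_le1 oppr_le0 ltW.
Qed.

Lemma gauss_series_cvg t (v : nat -> R) : 0 < t -> (forall k, `|v k| <= 1) ->
  cvgn (series (fun k => gauss t k.+1 * v k)).
Proof.
move=> t0 v1; apply: normed_cvg.
have e1 : expR (- t) < 1 by rewrite expR_lt1 oppr_lt0.
apply: (@series_le_cvg _ _ (geometric 1 (expR (- t)))).
- by move=> n; exact: normr_ge0.
- by move=> n; rewrite /= mul1r exprn_ge0// expR_ge0.
- move=> n; rewrite /= mul1r normrM (gtr0_norm (gauss_gt0 _ _)).
  apply: (@le_trans _ _ (gauss t n.+1)).
    by rewrite ler_piMr// ltW// gauss_gt0.
  apply: le_trans (gauss_le_geometric _ t0) _.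
  by rewrite exprS ler_piMl ?exprn_ge0 ?expR_ge0// ltW.
- by apply: is_cvg_geometric_series; rewrite gtr0_norm ?expR_gt0.
Qed.

Lemma trig_norm_ge1 k : 1 <= trig_norm k :> R.
Proof. by rewrite /trig_norm; have := pi_ge2 R; case: ifP => _; lra. Qed.

(** Geometric majorant of ratio exp(-t), each [trig_norm k] being at least 1. The bound is
    independent of the space variable, so it serves as the constant in both dominated convergences
    of [heat_form_cvg]. *)
Lemma gauss_sum_bound t : 0 < t ->
  exists C, forall n, \sum_(k < n) gauss t k / trig_norm k <= C.
Proof.
move=> t0; set r := expR (- t).
have r1 : r < 1 by rewrite expR_lt1 oppr_lt0.
have r0 : 0 < r by exact: expR_gt0.
have r1' : 0 < 1 - r by rewrite subr_gt0.
exists (1 - r)^-1 => n.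
apply: (@le_trans _ _ (\sum_(k < n) r ^+ k)).
  apply: ler_sum => k _; apply: le_trans (gauss_le_geometric k t0).
  by rewrite ler_pdivrMr ?trig_norm_gt0// ler_peMr ?trig_norm_ge1// ltW// gauss_gt0.
have -> : \sum_(k < n) r ^+ k = (1 - r ^+ n) / (1 - r).
  elim: n => [|n ih]; first by rewrite big_ord0 expr0 subrr mul0r.
  by rewrite big_ord_recr/= ih exprS; field; rewrite gt_eqF.
by rewrite -[leRHS]mul1r ler_pM2r ?invr_gt0// gerBl exprn_ge0// ltW.
Qed.

(** Dividing by [trig_norm] unites the constant term 1/(2 pi) and the factor 1/pi of the kernel in
    one formula. *)
Definition heat_sum (t : R) n (y : R) : R :=
  \sum_(k < n) gauss t k / trig_norm k * cosn k y.

Lemma heat_kernelE t y : 0 < t -> heat_kernel t y =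
  (2 * pi)^-1 + pi^-1 * limn (series (fun k => gauss t k.+1 * cosn k.+1 y)).
Proof.
move=> t0; have cw := @gauss_series_cvg t (fun k => cosn k.+1 y) t0
  (fun k => cos_max _).
rewrite /heat_kernel; congr (_ + _ * _).
apply/cvg_lim; first exact: Rhausdorff.
rewrite -cvg_shiftS; rewrite [X in X @ _](_ : _ =
  series (fun k => gauss t k.+1 * cosn k.+1 y)); first exact: cw.
by apply/funext => n; rewrite /series/= big_add1.
Qed.

Lemma heat_sum_cvg t y : 0 < t -> heat_sum t ^~ y @ \oo --> heat_kernel t y.
Proof.
move=> t0; have cw := @gauss_series_cvg t (fun k => cosn k.+1 y) t0
  (fun k => cos_max _).
rewrite heat_kernelE//.
rewrite -cvg_shiftS; rewrite [X in X @ _](_ : _ = (fun n => (2 * pi)^-1 +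
    pi^-1 * series (fun k => gauss t k.+1 * cosn k.+1 y) n)).
  by apply: cvgD; [exact: cvg_cst|apply: cvgMl_tmp; exact: cw].
apply/funext => n; rewrite /= /heat_sum big_ord_recl/= gauss0 mul1r.
have -> : cosn 0 y = 1 by rewrite /cosn mul0r cos0.
rewrite mulr1; congr (_ + _).
rewrite /series/= big_mkord mulr_sumr; apply: eq_bigr => i _.
by rewrite /trig_norm/= mulrCA mulrA; ring.
Qed.

Lemma heat_sum_bound t C n y :
  (forall n, \sum_(k < n) gauss t k / trig_norm k <= C) ->
  `|heat_sum t n y| <= C.
Proof.
move=> /(_ n); apply: le_trans; apply: le_trans (ler_norm_sum _ _ _) _.
apply: ler_sum => k _; rewrite normrM ger0_norm.
  by rewrite ler_piMr ?cos_max// divr_ge0// ltW ?gauss_gt0 ?trig_norm_gt0.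
by rewrite divr_ge0// ltW ?gauss_gt0 ?trig_norm_gt0.
Qed.

Section form.
Variables (f : R -> R) (t : R).
Hypothesis sf : sqint f.
Hypothesis t0 : 0 < t.

Let g k := gauss t k / trig_norm k.

Let inner_sum n x := f x *
  \sum_(k < n) trig_block (fun k => g k * ip f (cosn k))
    (fun k => g k * ip f (sinn k)) k x.

Let heat_sumB n x y : heat_sum t n (x - y) * f x * f y =
  f x * ((\sum_(k < n) trig_block (fun k => g k * cosn k x)
    (fun k => g k * sinn k x) k y) * f y).
Proof.
rewrite -mulrA mulrC -mulrA; congr (_ * _); rewrite mulrC; congr (_ * _).
rewrite /heat_sum; apply: eq_bigr => k _; rewrite /trig_block /cosn /sinn mulrBr cosB /g.
by ring.
Qed.

Let intg_heat_sumB n x : intg (fun y => heat_sum t n (x - y) * f x * f y).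
Proof.
under eq_fun do rewrite heat_sumB.
apply: intgZ; apply: sqint_mul => //; apply: sqint_sum => k.
exact: sqint_trig_block.
Qed.

Let inner_sumE n x :
  \int[mu]_(y in D) (heat_sum t n (x - y) * f x * f y) = inner_sum n x.
Proof.
pose p := trig_block (fun k => g k * cosn k x) (fun k => g k * sinn k x).
have sp k : sqint (p k) by exact: sqint_trig_block.
transitivity (f x * ip (fun y => \sum_(k < n) p k y) f).
  rewrite /ip -RintZ; last by apply: sqint_mul => //; exact: sqint_sum.
  by apply: eq_Rintegral => y _; rewrite heat_sumB.
rewrite ip_suml//; congr (_ * _); apply: eq_bigr => k _.
by rewrite ip_trig_block// /trig_block !(ipC _ f); ring.
Qed.

Let energy_sum n : \int[mu]_(x in D) inner_sum n x =
  \sum_(k < n) gauss t k * fourier_energy f k.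
Proof.
rewrite -[LHS]/(ip f _) ipC ip_suml//; last by move=> k; exact: sqint_trig_block.
apply: eq_bigr => k _; rewrite ip_trig_block// !(ipC _ f) /fourier_energy /g.
by field; rewrite gt_eqF// trig_norm_gt0.
Qed.

(** For finite sums the addition formula for cos (k (x - y)) separates the variables, so the
    iterated integral is explicit. Dominated convergence is applied first in y, with majorant C |f
    x| |f y|, then in x, with majorant C M |f x|. *)
Theorem heat_form_cvg : (fun n => \sum_(k < n) gauss t k * fourier_energy f k) @ \oo -->
  \int[mu]_(x in D) \int[mu]_(y in D) (heat_kernel t (x - y) * f x * f y).
Proof.
have [C hC] := gauss_sum_bound t0.
have C0 : 0 <= C by have := hC 0%N; rewrite big_ord0.
have iaf : intg (fun x => `|f x|) := integrable_norm (sqint_intg sf).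
have mf : measurable_fun D f by case: sf.
have hbound n x y : `|heat_sum t n (x - y) * f x * f y| <= C * `|f x| * `|f y|.
  rewrite !normrM ler_wpM2r// ler_wpM2r//.
  exact: heat_sum_bound hC.
have hcvg x y : (fun n => heat_sum t n (x - y) * f x * f y) @ \oo -->
    heat_kernel t (x - y) * f x * f y.
  by apply: cvgMr_tmp; apply: cvgMr_tmp; exact: heat_sum_cvg.
have minner n x := intg_measurable (intg_heat_sumB n x).
have inner_cvg x : (fun n => inner_sum n x) @ \oo -->
    \int[mu]_(y in D) (heat_kernel t (x - y) * f x * f y).
  under eq_fun do rewrite -inner_sumE.
  have [|||||_ //] := @Rint_dominated R
    (fun n y => heat_sum t n (x - y) * f x * f y)
    (fun y => heat_kernel t (x - y) * f x * f y) (fun y => C * `|f x| * `|f y|).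
  - by move=> n; exact: minner.
  - by apply: (measurable_fun_cvg (minner ^~ x)) => y _; exact: hcvg.
  - by apply: aeW => y _; exact: hcvg.
  - exact: intgZ.
  - by move=> n y _; exact: hbound.
have minner_sum n : measurable_fun D (inner_sum n).
  apply: measurable_funM => //.
  by case: (@sqint_sum R (trig_block (fun k => g k * ip f (cosn k))
    (fun k => g k * ip f (sinn k))) n (sqint_trig_block _ _)).
rewrite [X in X @ _](_ : _ = (fun n => \int[mu]_(x in D) inner_sum n x)); last first.
  by apply/funext => n; rewrite energy_sum.
pose M := \int[mu]_(y in D) `|f y|.
have [|||||_ //] := @Rint_dominated R inner_sum
  (fun x => \int[mu]_(y in D) (heat_kernel t (x - y) * f x * f y))
  (fun x => C * M * `|f x|).
- by [].
- by apply: (measurable_fun_cvg minner_sum) => x _; exact: inner_cvg.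
- by apply: aeW => x _; exact: inner_cvg.
- exact: intgZ.
- move=> n x Dx; rewrite -inner_sumE.
  apply: (le_trans (le_norm_Rint (intg_heat_sumB n x)
    (intgZ (C * `|f x|) iaf) (fun y _ => hbound n x y))).
  by rewrite RintZ// mulrAC.
Qed.

Definition heat_weight (t : R) k := (1 - gauss t k) / t.

Theorem J_series : (fun n => \sum_(k < n) heat_weight t k * fourier_energy f k) @ \oo -->
  J f t.
Proof.
rewrite /J L2norm_sqr// [X in X @ _](_ : _ = (fun n => t^-1 *
  (\sum_(k < n) fourier_energy f k - \sum_(k < n) gauss t k * fourier_energy f k))).
  apply: cvgMl_tmp; apply: cvgB; [exact: parseval|exact: heat_form_cvg].
apply/funext => n; rewrite -sumrB mulr_sumr; apply: eq_bigr => k _.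
by rewrite /heat_weight; field; rewrite gt_eqF.
Qed.

End form.
End heat.

(** * Monotonicity and limit of the energy *)

Section energy.
Context {R : realType}.
Implicit Types (s t : R) (f : R -> R).

Lemma heat_weight_ge0 t k : 0 < t -> 0 <= heat_weight t k.
Proof. by move=> t0; rewrite divr_ge0 ?(ltW t0)// subr_ge0 gauss_le1. Qed.

Lemma heat_weight_le t k : 0 < t -> heat_weight t k <= k%:R ^+ 2.
Proof.
move=> t0; rewrite /heat_weight ler_pdivrMr// /gauss.
by have := expR_ge1Dx (- (k%:R ^+ 2 * t)); lra.
Qed.

(** Quantitative form of the limit k^2, from exp(-u) <= 1/(1 + u) <= 1 - u + u^2 with u = k^2 t. The
    error is linear in t, so one choice of t serves all terms of a finite sum. *)
Lemma heat_weight_ge t k : 0 < t -> k%:R ^+ 2 - k%:R ^+ 4 * t <= heat_weight t k.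
Proof.
move=> t0; rewrite /heat_weight ler_pdivlMr// /gauss expRN.
have -> : k%:R ^+ 4 = (k%:R ^+ 2) ^+ 2 :> R by rewrite -exprM.
set a := k%:R ^+ 2.
have at0 : 0 <= a * t by rewrite mulr_ge0 ?sqr_ge0// ltW.
have h1 : (expR (a * t))^-1 <= (1 + a * t)^-1.
  by rewrite lef_pV2 ?posrE ?expR_gt0 ?expR_ge1Dx//; lra.
have h2 : (1 + a * t)^-1 <= 1 - a * t + (a * t) ^+ 2.
  rewrite -[leLHS]mul1r ler_pdivrMr; last by lra.
  have -> : (1 - a * t + (a * t) ^+ 2) * (1 + a * t) = 1 + (a * t) ^+ 3 by ring.
  by rewrite lerDl exprn_ge0.
have -> : (a - a ^+ 2 * t) * t = a * t - (a * t) ^+ 2 by ring.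
lra.
Qed.

(** The weight is the slope of a chord from 0 of the concave function 1 - exp(-a t), with a = k^2.
    Only exp(z) >= 1 + z is used: at z = -a (t - s) to compare the two exponentials, at z = a s to
    close the estimate. *)
Lemma heat_weight_nonincreasing s t k : 0 < s -> s <= t ->
  heat_weight t k <= heat_weight s k.
Proof.
move=> s0 st; have t0 : 0 < t by exact: lt_le_trans st.
rewrite /heat_weight ler_pdivrMr// mulrAC ler_pdivlMr// /gauss.
set a := k%:R ^+ 2; have a0 : 0 <= a by exact: sqr_ge0.
have -> : - (a * t) = - (a * s) + - (a * (t - s)) by ring.
rewrite expRD expRN; set E := expR (a * s).
have E0 : 0 < E by exact: expR_gt0.
have h1 := expR_ge1Dx (- (a * (t - s))).
have h2 : 1 + a * s <= E by exact: expR_ge1Dx.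
have i0 : 0 < E^-1 by rewrite invr_gt0.
have h3 : E^-1 * (1 + - (a * (t - s))) <= E^-1 * expR (- (a * (t - s))).
  by rewrite ler_pM2l.
have h4 : E^-1 * (1 + a * s) <= 1 by rewrite mulrC ler_pdivrMr// mul1r.
have ts : 0 <= t - s by rewrite subr_ge0.
have h5 := mulr_ge0 ts (_ : 0 <= 1 - E^-1 * (1 + a * s)).
have {}h5 : 0 <= (t - s) * (1 - E^-1 * (1 + a * s)) by apply: h5; rewrite subr_ge0.
have h6 : s * (E^-1 * (1 + - (a * (t - s)))) <= s * (E^-1 * expR (- (a * (t - s)))).
  by rewrite ler_pM2l.
lra.
Qed.

Variable f : R -> R.
Hypothesis sf : sqint f.
Notation e := (fourier_energy f).

Let e0 k : 0 <= e k. Proof. exact: fourier_energy_ge0. Qed.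

Lemma J_ge_sum t n : 0 < t -> \sum_(k < n) heat_weight t k * e k <= J f t.
Proof.
move=> t0; have := J_series sf t0; set u := (fun n => _) => cu.
have nu : nondecreasing_seq u.
  apply/nondecreasing_seqP => m; rewrite /u big_ord_recr/= lerDl.
  by rewrite mulr_ge0 ?heat_weight_ge0.
have {1}<- := cvg_lim (@Rhausdorff R) cu.
by apply: (nondecreasing_cvgn_le nu); apply/cvg_ex; exists (J f t).
Qed.

Lemma J_le t C : 0 < t -> (forall n, \sum_(k < n) heat_weight t k * e k <= C) ->
  J f t <= C.
Proof.
move=> t0 hC; have cu := J_series sf t0.
rewrite -(cvg_lim (@Rhausdorff R) cu); apply: limr_le.
  by apply/cvg_ex; exists (J f t).
exact: nearW.
Qed.

Lemma J_ge0 t : 0 < t -> 0 <= J f t.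
Proof. by move=> t0; have := J_ge_sum 0 t0; rewrite big_ord0. Qed.

Lemma J_nonincreasing s t : 0 < s -> s <= t -> J f t <= J f s.
Proof.
move=> s0 st; have t0 : 0 < t by exact: lt_le_trans st.
apply: J_le => // n; apply: le_trans (J_ge_sum n s0).
by apply: ler_sum => k _; rewrite ler_wpM2r// heat_weight_nonincreasing.
Qed.

Lemma J_le_dirichlet t C : 0 < t ->
  (forall n, \sum_(k < n) k%:R ^+ 2 * e k <= C) -> J f t <= C.
Proof.
move=> t0 hC; apply: J_le => // n; apply: le_trans (hC n).
by apply: ler_sum => k _; rewrite ler_wpM2r// heat_weight_le.
Qed.

Lemma dirichlet_sum_le t n : 0 < t ->
  \sum_(k < n) k%:R ^+ 2 * e k <= J f t + t * \sum_(k < n) k%:R ^+ 4 * e k.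
Proof.
move=> t0; rewrite -lerBlDr; apply: le_trans (J_ge_sum n t0).
rewrite mulr_sumr -sumrB; apply: ler_sum => k _.
rewrite mulrA -mulrBl ler_wpM2r// [t * _]mulrC; exact: heat_weight_ge.
Qed.

Let small_time n (eps : R) : 0 < eps -> exists2 d, 0 < d &
  forall t, 0 < t -> t <= d -> t * \sum_(k < n) k%:R ^+ 4 * e k <= eps.
Proof.
move=> eps0; set B := \sum_(k < n) _.
have B0 : 0 <= B by apply: sumr_ge0 => k _; rewrite mulr_ge0// exprn_ge0.
have B1 : 0 < B + 1 by lra.
exists (eps / (B + 1)); first by rewrite divr_gt0.
move=> t t0 td; apply: (@le_trans _ _ (eps / (B + 1) * B)).
  by rewrite ler_wpM2r.
by rewrite mulrAC ler_pdivrMr// ler_pM2l// lerDl.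
Qed.

(** For fixed n, letting t tend to 0 in [dirichlet_sum_le] removes the sum of fourth powers. *)
Lemma dirichlet_sum_bounded C : (forall t, 0 < t -> J f t <= C) ->
  forall n, \sum_(k < n) k%:R ^+ 2 * e k <= C.
Proof.
move=> hC n; apply/ler_addgt0Pr => eps eps0.
have [d d0 hd] := small_time n eps0.
apply: le_trans (dirichlet_sum_le n d0) _.
by apply: lerD; [exact: hC|exact: hd].
Qed.

(** From above, [J f t] never exceeds L. From below, a partial sum within eps/2 of L is fixed first,
    and t is then taken small depending on it. *)
Lemma J_cvg (L : R) : (fun n => \sum_(k < n) k%:R ^+ 2 * e k) @ \oo --> L ->
  J f t @[t --> 0^'+] --> L.
Proof.
move=> cL.
have leL n : \sum_(k < n) k%:R ^+ 2 * e k <= L.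
  rewrite -(cvg_lim (@Rhausdorff R) cL).
  apply: (@nondecreasing_cvgn_le _ (fun n => \sum_(k < n) k%:R ^+ 2 * e k)).
    apply/nondecreasing_seqP => m; rewrite big_ord_recr/= lerDl.
    by rewrite mulr_ge0// sqr_ge0.
  by apply/cvg_ex; exists L.
apply/cvgrPdist_le => eps eps0.
have eps2 : 0 < eps / 2 by rewrite divr_gt0.
move/cvgrPdist_le : (cL) => /(_ _ eps2)[n _ /(_ n (leqnn n))] hn.
have [d d0 hd] := small_time n eps2.
near=> t.
have t0 : 0 < t by near: t; exact: nbhs_right_gt.
have td : t <= d by near: t; exact: nbhs_right_le.
have h1 := dirichlet_sum_le n t0; have h2 := hd t t0 td.
have h3 := J_le_dirichlet t0 leL.
rewrite ger0_norm ?subr_ge0//.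
move: hn; rewrite ger0_norm ?subr_ge0//; lra.
Unshelve. all: by end_near. Qed.

End energy.

(** * The bilateral exponential form of the heat kernel *)

Section bilateral.
Context {R : realType}.

Lemma complex_cvg (u v : R^nat) (p q : R) : u @ \oo --> p -> v @ \oo --> q ->
  ((fun n => u n +i* v n) : nat -> (R[i] : numFieldType)) @ \oo -->
  ((p +i* q) : (R[i] : numFieldType)).
Proof.
(* In the order on [R[i]] a positive number has imaginary part 0, so the tolerance is in fact the
   real number [e]. *)
move=> up vq; apply/cvgrPdist_lt => -[e e'] /[!ltcE]/= /andP[/eqP e'0 e0].
have e2 : 0 < e / 2 by rewrite divr_gt0.
move/cvgrPdist_lt : up => /(_ _ e2) hu; move/cvgrPdist_lt : vq => /(_ _ e2) hv.
near=> n.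
have hun : `|p - u n| < e / 2 by near: n.
have hvn : `|q - v n| < e / 2 by near: n.
rewrite /= normc_def/= ltcE/= -e'0 eqxx/=.
apply: (@le_lt_trans _ _ (`|p - u n| + `|q - v n|)); last by lra.
rewrite -[leRHS]ger0_norm ?addr_ge0// -sqrtr_sqr ler_wsqrtr//.
rewrite -(real_normK (num_real (p - u n))) -(real_normK (num_real (q - v n))).
have := mulr_ge0 (normr_ge0 (p - u n)) (normr_ge0 (q - v n)).
by rewrite !expr2; lra.
Unshelve. all: by end_near. Qed.

Lemma sum_complex (u v : nat -> R) n :
  \sum_(0 <= k < n) (u k +i* v k : R[i]) =
  (\sum_(0 <= k < n) u k) +i* (\sum_(0 <= k < n) v k).
Proof.
elim: n => [|n ih]; first by rewrite !big_geq.
by rewrite !big_nat_recr//= ih.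
Qed.

(** The series over negative k is the conjugate of the one over positive k, so the imaginary parts
    cancel and the cosine series counts twice. *)
Lemma heat_kernel_bilateral (t y : R) : 0 < t ->
  has_bilateral_sum
    (fun k : int => (expR (- (k%:~R ^+ 2 * t)))%:C * expi (k%:~R * y))
    ((2 * pi * heat_kernel t y)%:C).
Proof.
move=> t0.
pose c k := gauss t k.+1 * cosn k.+1 y.
pose s k := gauss t k.+1 * sinn k.+1 y.
have cc : cvgn (series c) by apply: gauss_series_cvg => // k; exact: cos_max.
have cs : cvgn (series s) by apply: gauss_series_cvg => // k; exact: sin_max.
exists ((1 + limn (series c)) +i* limn (series s)).
exists (limn (series c) +i* (- limn (series s))).
(* Shifting by one index isolates the term k = 0, which is 1. *)
have pos n : series (fun n : nat => (expR (- ((n%:Z)%:~R ^+ 2 * t)))%:C *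
    expi ((n%:Z)%:~R * y)) n.+1 = (1 + series c n) +i* series s n.
  rewrite /series/= big_nat_recl// mul0r /expi cos0 sin0 expr0n mul0r oppr0 expR0.
  rewrite mulr1 (eq_bigr (fun k => c k +i* s k)); last first.
    by move=> k _; rewrite /c /s /gauss /cosn /sinn; simpc.
  by rewrite sum_complex; simpc.
have neg n : series (fun n : nat => (expR (- ((- n.+1%:Z)%:~R ^+ 2 * t)))%:C *
    expi ((- n.+1%:Z)%:~R * y)) n = series c n +i* - series s n.
  rewrite /series/= (eq_bigr (fun k => c k +i* - s k)); last first.
    move=> k _; rewrite /c /s /gauss /cosn /sinn /expi mulrNz sqrrN mulNr cosN sinN.
    by simpc.
  by rewrite sum_complex sumrN.
split.
- rewrite -cvg_shiftS (_ : [sequence _]_n =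
      fun n => (1 + series c n) +i* series s n); last first.
    by apply/funext => n; exact: pos.
  by apply: complex_cvg => //; apply: cvgD => //; exact: cvg_cst.
- rewrite (_ : series _ = fun n => series c n +i* - series s n); last first.
    by apply/funext => n; exact: neg.
  by apply: complex_cvg => //; exact: cvgN.
- rewrite heat_kernelE// -/c; apply/eqP; rewrite eq_complex/= subrr eqxx andbT.
  have pi0 : (pi : R) != 0 by rewrite gt_eqF ?pi_gt0.
  by apply/eqP; move: (pi : R) pi0 => p p0; field.
Qed.

End bilateral.

(** * Smooth cutoff functions *)

Section smooth.
Context {R : realType}.
Implicit Types (f g : R -> R) (n : nat) (a b x : R).

(** Recursion on the derivative makes each closure property an induction on the order, since
    derivatives of products and inverses are built from the same operations. *)
Fixpoint smooth_upto n f : Prop :=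
  if n is m.+1 then (forall x, derivable f x 1) /\ smooth_upto m (f^`())%classic
  else True.

Lemma smooth_uptoS n f (df : R -> R) : (forall x, is_derive x 1 f (df x)) ->
  smooth_upto n df -> smooth_upto n.+1 f.
Proof.
move=> dF sdf; split=> [x|]; first by have [] := dF x.
suff -> : (f^`())%classic = df by [].
by apply/funext => x; rewrite derive1E; have [] := dF x.
Qed.

Lemma smooth_upto_is_derive n f x : smooth_upto n.+1 f ->
  is_derive x 1 f ((f^`())%classic x).
Proof. by move=> [df _]; rewrite derive1E; apply: derivableP. Qed.

Lemma smooth_uptoW n f : smooth_upto n.+1 f -> smooth_upto n f.
Proof.
elim: n f => [//|n ih] f [df sdf]; split => //.
exact: ih.
Qed.

Lemma smooth_upto_derivable f : (forall n, smooth_upto n f) ->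
  forall n x, derivable (f^`(n))%classic x 1.
Proof.
move=> sf n; have := sf n.+1; elim: n f {sf} => [f []//|n ih f [df sdf]].
by rewrite derive1Sn; apply: ih.
Qed.

Lemma smooth_upto_cst n a : smooth_upto n (fun=> a).
Proof.
elim: n a => [//|n ih] a.
by apply: (smooth_uptoS (df := fun=> 0)) (ih 0) => x; exact: is_derive_cst.
Qed.

Lemma smooth_uptoD n f g : smooth_upto n f -> smooth_upto n g ->
  smooth_upto n (fun x => f x + g x).
Proof.
elim: n f g => [//|n ih] f g sf sg.
apply: smooth_uptoS (ih _ _ sf.2 sg.2) => x.
by apply: is_derive_addf;
  [exact: (smooth_upto_is_derive _ sf)|exact: (smooth_upto_is_derive _ sg)].
Qed.

Lemma smooth_uptoM n f g : smooth_upto n f -> smooth_upto n g ->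
  smooth_upto n (fun x => f x * g x).
Proof.
elim: n f g => [//|n ih] f g sf sg.
apply: smooth_uptoS (smooth_uptoD (ih _ _ sf.2 (smooth_uptoW sg))
  (ih _ _ (smooth_uptoW sf) sg.2)) => x.
by apply: is_derive_mulf;
  [exact: (smooth_upto_is_derive _ sf)|exact: (smooth_upto_is_derive _ sg)].
Qed.

Lemma smooth_upto_affine n f a b : smooth_upto n f ->
  smooth_upto n (fun x => f (a * x + b)).
Proof.
elim: n f => [//|n ih] f sf.
apply: smooth_uptoS (smooth_uptoM (smooth_upto_cst n a) (ih _ sf.2)) => x.
by apply: is_derive_comp_affine; exact: (smooth_upto_is_derive _ sf).
Qed.

Lemma is_derive_inv f x df : f x != 0 -> is_derive x 1 f df ->
  is_derive x 1 (fun y => (f y)^-1) (-1 * df * ((f x)^-1 * (f x)^-1)).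
Proof.
move=> fx0 h; apply: (is_derive_eq (is_deriveV fx0 h)).
by rewrite /GRing.scale/= -exprVn expr2; ring.
Qed.

Lemma smooth_uptoV n f : (forall x, f x != 0) -> smooth_upto n f ->
  smooth_upto n (fun x => (f x)^-1).
Proof.
move=> f0; elim: n => [//|n ih] sf.
have sV := ih (smooth_uptoW sf).
apply: smooth_uptoS (smooth_uptoM (smooth_uptoM (smooth_upto_cst n (-1)) sf.2)
  (smooth_uptoM sV sV)) => x.
by apply: is_derive_inv => //; exact: (smooth_upto_is_derive _ sf).
Qed.

Lemma smooth_upto_trig_block n (c d : nat -> R) k :
  smooth_upto n (trig_block c d k).
Proof.
elim: n c d => [//|n ih] c d.
apply: smooth_uptoS (ih (fun k => k%:R * d k) (fun k => - (k%:R * c k))) => x.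
apply: (is_derive_eq (is_derive_addf (is_derive_scalef (c k) (is_derive_cosn k x))
  (is_derive_scalef (d k) (is_derive_sinn k x)))).
by rewrite /trig_block; ring.
Qed.

Lemma poly_growth (p : {poly R}) : exists A m, forall y, 1 <= y ->
  `|p.[y]| <= A * y ^+ m.
Proof.
elim/poly_ind: p => [|p c [A [m h]]].
  by exists 0, 0%N => y _; rewrite horner0 normr0 mul0r.
exists (A + `|c|), m.+1 => y y1; have y0 : 0 <= y by lra.
rewrite hornerMXaddC mulrDl; apply: le_trans (ler_normD _ _) _.
apply: lerD; last by rewrite ler_peMr// exprn_ege1.
by rewrite normrM (ger0_norm y0) exprSr mulrA ler_wpM2r// h.
Qed.

(** From exp(y) >= y^(m+2) / (m+2)!, with m the growth exponent of [p]. Decay of order y^-2 rather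
    than y^-1 leaves a vanishing factor in the difference quotient of [flat] at 0. *)
Lemma poly_exp_decay (p : {poly R}) : exists C, forall y, 1 <= y ->
  `|p.[y] * expR (- y)| <= C * y ^- 2.
Proof.
have [A [m h]] := poly_growth p; exists (A * (m.+2)`!%:R) => y y1.
have y0 : 0 < y by lra.
rewrite normrM (gtr0_norm (expR_gt0 _)) expRN.
have f0 : 0 < (m.+2)`!%:R :> R by rewrite ltr0n fact_gt0.
have A0 : 0 <= A * y ^+ m := le_trans (normr_ge0 _) (h _ y1).
have h1 : y ^+ m.+2 / (m.+2)`!%:R <= expR y.
  by apply: le_trans (expR_ge1Dxn m.+1 (ltW y0)); rewrite lerDr.
have h2 : (expR y)^-1 <= (m.+2)`!%:R / y ^+ m.+2.
  rewrite -[leRHS]invf_div lef_pV2 ?posrE ?expR_gt0//.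
  by rewrite divr_gt0// exprn_gt0.
apply: (@le_trans _ _ (A * y ^+ m * ((m.+2)`!%:R / y ^+ m.+2))).
  by apply: ler_pM => //; exact: h.
rewrite le_eqVlt; apply/orP; left; apply/eqP.
rewrite -(addn2 m) exprD; field.
by rewrite expf_neq0 ?gt_eqF.
Qed.

(* The derivative of [p (1/x) exp (-1/x)] has the same shape, with [p] replaced
   by [X^2 (p - p')]. *)
Definition flat (p : {poly R}) x : R :=
  if 0 < x then p.[x^-1] * expR (- x^-1) else 0.

Lemma is_derive_flat (p : {poly R}) x :
  is_derive x 1 (flat p) (flat ('X^2 * (p - p^`())) x).
Proof.
have [x0|x0|x0] := ltgtP x 0.
- rewrite {2}/flat ltNge (ltW x0)/=.
  apply: (near_eq_is_derive _ (is_derive_cst 0 x 1)).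
  near=> y; rewrite /flat; case: ltP => // y0.
  have : y < 0 by near: y; exact: lt_nbhsl.
  by move=> /lt_trans /(_ y0); rewrite ltxx.
- rewrite {2}/flat x0.
  have xn0 : x != 0 by rewrite gt_eqF.
  have dV : is_derive x 1 (fun y : R => y^-1) (- x ^- 2).
    apply: (is_derive_eq (is_derive_inv xn0 (is_derive_id x 1))).
    by rewrite -exprVn expr2; ring.
  have d1 : is_derive x 1 (fun y : R => p.[y^-1]) (p^`().[x^-1] * - x ^- 2).
    exact: (is_derive1_comp (is_derive_poly p x^-1) dV).
  have dN : is_derive x 1 (fun y : R => - y^-1) (x ^- 2).
    by apply: (is_derive_eq (is_deriveN dV)); rewrite opprK.
  have d2 : is_derive x 1 (fun y : R => expR (- y^-1)) (expR (- x^-1) * x ^- 2).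
    have dE : is_derive (- x^-1) 1 (@expR R) (expR (- x^-1)) by exact: is_derive_expR.
    exact: (is_derive1_comp (g := fun y : R => - y^-1) dE dN).
  have d3 := is_derive_mulf d1 d2.
  apply: (is_derive_eq (near_eq_is_derive _ d3)).
    near=> y; rewrite /flat; case: ltP => // y0.
    have : 0 < y by near: y; exact: lt_nbhsr.
    by rewrite ltNge y0.
  rewrite hornerM hornerXn hornerD hornerN exprVn; ring.
- rewrite x0 {2}/flat ltxx.
  have [C hC] := poly_exp_decay p.
  have C0 : 0 <= C.
    have := hC 1 (lexx _); rewrite expr1n invr1 mulr1; exact: le_trans.
  (* For h > 0 the decay estimate at 1/h bounds the quotient by C h; for h < 0 the quotient is 0. *)
  have H : h^-1 *: (flat p (h *: 1 + 0) - flat p 0) @[h --> 0^'] --> (0 : R).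
    apply/cvgrPdist_le => eps eps0.
    have C1 : 0 < C + 1 by lra.
    near=> h.
    have hn0 : h != 0 by near: h; exact: nbhs_dnbhs_neq.
    have h1 : `|h| <= 1.
      by near: h; apply: dnbhs0_le.
    have h2 : `|h| <= eps / (C + 1).
      by near: h; apply: dnbhs0_le; rewrite divr_gt0.
    rewrite sub0r normrN {2}/flat ltxx subr0 addr0 /GRing.scale/= mulr1.
    rewrite /flat; case: ltP => h0; last by rewrite mulr0 normr0 ltW.
    rewrite (gtr0_norm h0) in h1 h2.
    have := hC h^-1; rewrite invf_ge1// h1 => /(_ isT); rewrite exprVn invrK => hh.
    rewrite normrM gtr0_norm ?invr_gt0// ler_pdivrMl//; apply: le_trans hh _.
    rewrite expr2 mulrA [leRHS]mulrC ler_pM2r//.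
    apply: (@le_trans _ _ (C * (eps / (C + 1)))); first by rewrite ler_wpM2l.
    by rewrite mulrCA ler_piMr ?(ltW eps0)// ler_pdivrMr// mul1r lerDl.
  apply: DeriveDef; first by apply/cvg_ex; exists 0.
  exact: cvg_lim H.
Unshelve. all: by end_near. Qed.

Lemma smooth_upto_flat n p : smooth_upto n (flat p).
Proof.
elim: n p => [//|n ih] p.
exact: (smooth_uptoS (is_derive_flat p) (ih _)).
Qed.

Let h x := flat 1 x.

Let h_gt0 x : 0 < x -> 0 < h x.
Proof. by move=> x0; rewrite /h /flat x0 hornerC mul1r expR_gt0. Qed.

Let h_le0 x : x <= 0 -> h x = 0.
Proof. by move=> x0; rewrite /h /flat ltNge x0. Qed.

Let h_ge0 x : 0 <= h x.
Proof. by have [/h_le0->|/h_gt0/ltW] := leP x 0. Qed.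

(** The classical smooth transition a / (a + b) with a = flat 1 (x - 1) and b = flat 1 (2 - x); the
    arguments are spelled in the form [a * x + b] of [smooth_upto_affine]. *)
Definition smooth_step x : R :=
  flat 1 (1 * x + -1) * (flat 1 (1 * x + -1) + flat 1 (-1 * x + 2))^-1.

(** The two arguments add up to 1, so at least one is positive. *)
Let den_gt0 x : 0 < flat 1 (1 * x + -1) + flat 1 (-1 * x + 2).
Proof.
have [x1|x1] := ltP 1 x.
  by rewrite ltr_pwDl ?h_ge0//; apply: h_gt0; lra.
by rewrite ltr_wpDl ?h_ge0//; apply: h_gt0; lra.
Qed.

Lemma smooth_upto_step n : smooth_upto n smooth_step.
Proof.
have s1 := smooth_upto_affine 1 (-1) (smooth_upto_flat n 1).
have s2 := smooth_upto_affine (-1) 2 (smooth_upto_flat n 1).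
apply: smooth_uptoM => //; apply: smooth_uptoV; last exact: smooth_uptoD.
by move=> x; apply: lt0r_neq0; exact: den_gt0.
Qed.

Lemma smooth_step_le1 x : x <= 1 -> smooth_step x = 0.
Proof.
by move=> x1; rewrite /smooth_step [X in X * _](h_le0 (x := 1 * x + -1)) ?mul0r//; lra.
Qed.

Lemma smooth_step_ge2 x : 2 <= x -> smooth_step x = 1.
Proof.
move=> x2; have := den_gt0 x; rewrite /smooth_step.
rewrite [flat 1 (-1 * x + 2)](h_le0 (x := -1 * x + 2)); last by lra.
by rewrite addr0 => /gt_eqF h0; rewrite divff// h0.
Qed.

Lemma smooth_step_itv x : 0 <= smooth_step x <= 1.
Proof.
have h1 := h_ge0 (1 * x + -1); have h2 := h_ge0 (-1 * x + 2).
apply/andP; split; first by apply: divr_ge0 => //; exact/ltW/den_gt0.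
by rewrite /smooth_step ler_pdivrMr ?den_gt0// [leRHS]mul1r lerDl.
Qed.

Notation dstep := (smooth_step^`())%classic.

Lemma is_derive_step x : is_derive x 1 smooth_step (dstep x).
Proof. exact: smooth_upto_is_derive (smooth_upto_step 1). Qed.

Lemma derive_step_lt1 x : x < 1 -> dstep x = 0.
Proof.
move=> x1; rewrite derive1E.
have /@derive_val-> // : is_derive x 1 smooth_step 0.
apply: (near_eq_is_derive _ (is_derive_cst 0 x 1)).
near=> y; rewrite smooth_step_le1//; apply: ltW.
by near: y; exact: lt_nbhsl.
Unshelve. all: by end_near. Qed.

Lemma derive_step_gt2 x : 2 < x -> dstep x = 0.
Proof.
move=> x2; rewrite derive1E.
have /@derive_val-> // : is_derive x 1 smooth_step 0.
apply: (near_eq_is_derive _ (is_derive_cst (1 : R) x 1)).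
near=> y; rewrite smooth_step_ge2//; apply: ltW.
by near: y; exact: lt_nbhsr.
Unshelve. all: by end_near. Qed.

(** The derivative is continuous and vanishes outside [1, 2], so compactness of that interval
    suffices. *)
Lemma derive_step_bounded : exists2 M, 0 <= M & forall x, `|dstep x| <= M.
Proof.
have cd : continuous dstep.
  move=> x; apply/differentiable_continuous/derivable1_diffP.
  by have [_ []] := smooth_upto_step 2.
have /continuous_compact : {within `[1, 2], continuous dstep}.
  exact: continuous_subspaceT.
move=> /(_ (@segment_compact _ _ _)) /compact_bounded [M [_ hM]].
exists (`|M| + 1); first by rewrite addr_ge0.
move=> x; have [x1|x1] := ltP x 1.
  by rewrite derive_step_lt1// normr0 addr_ge0.
have [x2|x2] := ltP 2 x.
  by rewrite derive_step_gt2// normr0 addr_ge0.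
apply: (hM (`|M| + 1)); last by exists x => //=; rewrite in_itv/= x1.
by apply: le_lt_trans (ler_norm _) _; rewrite ltrDl.
Qed.

(** The arguments are N+1 times the signed distances to the two ends. Since [smooth_step] vanishes
    up to 1 and not merely up to 0, the cutoff is 0 on strips of width 1/(N+1), which gives compact
    support in the open interval. *)
Definition cutoff N x : R :=
  smooth_step (N.+1%:R * x + N.+1%:R * pi) *
  smooth_step (- N.+1%:R * x + N.+1%:R * pi).

Definition dcutoff N x : R :=
  N.+1%:R * dstep (N.+1%:R * x + N.+1%:R * pi) *
    smooth_step (- N.+1%:R * x + N.+1%:R * pi) +
  smooth_step (N.+1%:R * x + N.+1%:R * pi) *
    (- N.+1%:R * dstep (- N.+1%:R * x + N.+1%:R * pi)).

Lemma smooth_upto_cutoff n N : smooth_upto n (cutoff N).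
Proof. by apply: smooth_uptoM; apply: smooth_upto_affine; exact: smooth_upto_step. Qed.

Lemma is_derive_cutoff N x : is_derive x 1 (cutoff N) (dcutoff N x).
Proof.
by apply: is_derive_mulf; apply: is_derive_comp_affine; exact: is_derive_step.
Qed.

Lemma cutoff_itv N x : 0 <= cutoff N x <= 1.
Proof.
have /andP[a0 a1] := smooth_step_itv (N.+1%:R * x + N.+1%:R * pi).
have /andP[b0 b1] := smooth_step_itv (- N.+1%:R * x + N.+1%:R * pi).
by rewrite mulr_ge0//= mulr_ile1.
Qed.

Let inv_atom N : exists i : R, [/\ N.+1%:R^-1 = i, 0 < N.+1%:R :> R & N.+1%:R * i = 1].
Proof. by exists N.+1%:R^-1; split; rewrite ?ltr0n// divff. Qed.

Lemma cutoff_eq0 N x : x \notin `[- pi + N.+1%:R^-1, pi - N.+1%:R^-1] ->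
  cutoff N x = 0.
Proof.
rewrite /cutoff; have [i [->]] := inv_atom N.
move: (N.+1%:R : R) => m m0 mi.
rewrite in_itv/= negb_and -!ltNge => /orP[hx|hx].
  by rewrite smooth_step_le1 ?mul0r//; nra.
by rewrite mulrC smooth_step_le1 ?mul0r//; nra.
Qed.

Lemma cutoff_eq1 N x : - pi + 2 / N.+1%:R <= x -> x <= pi - 2 / N.+1%:R ->
  cutoff N x = 1.
Proof.
rewrite /cutoff; have [i [->]] := inv_atom N.
move: (N.+1%:R : R) => m m0 mi h1 h2.
by rewrite !smooth_step_ge2 ?mulr1//; nra.
Qed.

Lemma dcutoff_eq0 N x : - pi + 2 / N.+1%:R < x -> x < pi - 2 / N.+1%:R ->
  dcutoff N x = 0.
Proof.
rewrite /dcutoff; have [i [->]] := inv_atom N.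
move: (N.+1%:R : R) => m m0 mi h1 h2.
by rewrite !derive_step_gt2 ?mulr0 ?mul0r ?addr0//; nra.
Qed.

Lemma dcutoff_bound M N x : (forall x, `|dstep x| <= M) ->
  `|dcutoff N x| <= 2 * N.+1%:R * M.
Proof.
move=> hM.
have /andP[a0 a1] := smooth_step_itv (N.+1%:R * x + N.+1%:R * pi).
have /andP[b0 b1] := smooth_step_itv (- N.+1%:R * x + N.+1%:R * pi).
have h1 := hM (N.+1%:R * x + N.+1%:R * pi).
have h2 := hM (- N.+1%:R * x + N.+1%:R * pi).
have -> : 2 * N.+1%:R * M = N.+1%:R * M + N.+1%:R * M by ring.
apply: le_trans (ler_normD _ _) _; apply: lerD.
- rewrite normrM (ger0_norm b0) normrM normr_nat.
  apply: (@le_trans _ _ (N.+1%:R * `|dstep (N.+1%:R * x + N.+1%:R * pi)|)).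
    by rewrite ler_piMr// mulr_ge0.
  exact: (ler_wpM2l (ler0n _ _) h1).
- rewrite normrM (ger0_norm a0) normrM normrN normr_nat.
  apply: (@le_trans _ _ (N.+1%:R * `|dstep (- N.+1%:R * x + N.+1%:R * pi)|)).
    by rewrite ler_piMl// mulr_ge0.
  exact: (ler_wpM2l (ler0n _ _) h2).
Qed.

Lemma cutoff_continuous N : continuous (cutoff N).
Proof. exact: is_derive_continuous (is_derive_cutoff N). Qed.

Lemma dcutoff_continuous N : continuous (dcutoff N).
Proof.
have -> : dcutoff N = ((cutoff N)^`())%classic.
  by apply/funext => x; rewrite derive1E; have [_ ->] := is_derive_cutoff N x.
move=> x; apply/differentiable_continuous/derivable1_diffP.
by have [_ []] := smooth_upto_cutoff 2 N.
Qed.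

Lemma near_div_small (d : R) : 0 < d -> \forall N \near \oo, 2 / N.+1%:R < d.
Proof.
move=> d0; exists (Num.bound (2 / d)) => // N /= hN.
rewrite ltr_pdivrMr// mulrC -ltr_pdivrMr//.
have d20 : 0 <= 2 / d by rewrite divr_ge0// ltW.
by apply: lt_le_trans (archi_boundP d20) _; rewrite ler_nat (leq_trans hN).
Qed.

Lemma cutoff_cvg x : - pi < x -> x < pi -> cutoff ^~ x @ \oo --> (1 : R).
Proof.
move=> x1 x2; apply: cvg_near_cst.
have d1 : 0 < x + pi by lra.
have d2 : 0 < pi - x by lra.
near=> N; apply: cutoff_eq1.
  have : 2 / N.+1%:R < x + pi by near: N; exact: near_div_small.
  by move: (2 / N.+1%:R) => i; lra.
have : 2 / N.+1%:R < pi - x by near: N; exact: near_div_small.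
by move: (2 / N.+1%:R) => i; lra.
Unshelve. all: by end_near. Qed.

End smooth.

(** * Fourier coefficients of weak derivatives *)

Section weak_derivative_coefficients.
Context {R : realType}.
Notation mu := (@lebesgue_measure R).
Notation D := (@circle R).
Notation intg f := (mu.-integrable D (EFin \o f)).
Let measurable_D := @measurable_circle R.
Hint Resolve measurable_D : core.

Lemma sqint_mul_continuous (u v : R -> R) : continuous u -> continuous v ->
  sqint (fun x => u x * v x).
Proof.
move=> cu cv; apply: sqint_continuous => x.
by apply: cvgM; [exact: cu|exact: cv].
Qed.

Lemma ip_cutoff_cvg (v w : R -> R) : sqint v -> continuous w ->
  (fun N => ip v (fun x => cutoff N x * w x)) @ \oo --> ip v w.
Proof.
move=> sv cw; have sw := sqint_continuous cw.
have [|||||_ //] := @Rint_dominated R (fun N x => v x * (cutoff N x * w x))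
  (fun x => v x * w x) (fun x => `|v x * w x|).
- move=> N; apply: measurable_funM; first by case: sv.
  by case: (sqint_mul_continuous (@cutoff_continuous R N) cw).
- by apply: measurable_funM; [case: sv|case: sw].
- apply: ae_mono (ae_and (ae_neq pi) (ae_neq (- pi))) => x [x1 x2] Dx.
  have {x1 x2} [x1 x2] : - pi < x /\ x < pi.
    by move: Dx; rewrite /circle/= in_itv/= !lt_neqAle (eq_sym _ x) x1 x2 => /andP[].
  have h : (fun N => cutoff N x * w x) @ \oo --> w x.
    by have := cvgMr_tmp (b := w x) (cutoff_cvg x1 x2); rewrite mul1r; apply.
  exact: cvgMl_tmp.
- exact: (integrable_norm (sqint_mul sv sw)).
- move=> N x _; rewrite mulrCA normrM ler_piMl//.
  by have /andP[h0 h1] := cutoff_itv N x; rewrite ger0_norm.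
Qed.

Lemma Rintegral_indic (A : set R) : measurable A -> A `<=` D ->
  \int[mu]_(x in D) (\1_A x) = fine (mu A).
Proof.
move=> mA AD; rewrite /Rintegral integral_indic//.
by rewrite (_ : A `&` D = A)//; apply/setIidPl.
Qed.

Lemma intg_indic (A : set R) : measurable A -> intg (\1_A : R -> R).
Proof.
move=> mA; apply: (@intg_bounded _ _ 1); first exact: measurable_indic.
by move=> x _; rewrite indicE; case: (_ \in _); rewrite ?normr1 ?normr0.
Qed.

Let edges_left (r : R) : set R := `[- pi, - pi + r]%classic.
Let edges_right (r : R) : set R := `[pi - r, pi]%classic.

(** [B] is the majorant for [ip_dcutoff_cvg0], where the strips have width 2/(N+1) and carry the
    support of [dcutoff N]. *)
Lemma Rintegral_edges (K r : R) : 0 <= r -> r <= pi ->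
  let B x := K * (\1_(edges_left r) x + \1_(edges_right r) x) in
  intg B /\ \int[mu]_(x in D) B x = K * (r + r).
Proof.
move=> r0 rpi B.
have m1 : measurable (edges_left r) by exact: measurable_itv.
have m2 : measurable (edges_right r) by exact: measurable_itv.
have i1 := intg_indic m1; have i2 := intg_indic m2.
have i12 := intgD i1 i2.
split; first exact: intgZ.
rewrite /B RintZ// RintD// !Rintegral_indic//.
- rewrite /edges_left /edges_right !lebesgue_measure_itv/= !lte_fin.
  congr (_ * (_ + _)).
    by case: ltP => h /=; lra.
  by case: ltP => h /=; lra.
- by move=> x; rewrite /edges_right /circle/= !in_itv/= => /andP[? ?]; lra.
- by move=> x; rewrite /edges_left /circle/= !in_itv/= => /andP[? ?]; lra.
Qed.

(* [dcutoff N] has integral 0, is of size O(N), and is supported on two edge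
   intervals of length O(1/N); so it only sees the equal boundary values of w. *)
Lemma ip_dcutoff_cvg0 (w : R -> R) : {within D, continuous w} ->
  w (- pi) = w pi -> (fun N => ip w (dcutoff N)) @ \oo --> (0 : R).
Proof.
move=> cw wpi; have sw := sqint_within_continuous cw.
pose c := w pi; have sc : sqint (fun=> c : R).
  by apply: sqint_continuous; exact: cst_continuous.
have swc := sqintB sw sc.
have sd N : sqint (@dcutoff R N).
  by apply: sqint_continuous; exact: dcutoff_continuous.
have ipE N : ip w (dcutoff N) = ip (fun x => w x - c) (dcutoff N).
  rewrite ipBl// [ip (fun=> c) _](_ : _ = 0) ?subr0//.
  rewrite /ip RintZ; last exact: sqint_intg.
  rewrite (circle_FTC2 (is_derive_cutoff N)).
    rewrite !cutoff_eq0 ?subrr ?mulr0// in_itv/= negb_and -!ltNge.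
      by apply/orP; left; rewrite ltrDl invr_gt0.
    by apply/orP; right; rewrite gtrBl invr_gt0.
  by apply: continuous_subspaceT; exact: dcutoff_continuous.
under eq_fun do rewrite ipE.
have [M M0 hM] := @derive_step_bounded R.
apply/cvgr0Pnorm_le => eps eps0.
(* The majorant will have integral e (2 (N+1) M) (4 / (N+1)) = 8 M e, which is independent of N and
   below eps. *)
pose e := eps / (8 * M + 1).
have M1 : 0 < 8 * M + 1 by lra.
have e0 : 0 < e by rewrite divr_gt0.
have [_ wl wr] := (continuous_within_itvP _ (@circle_lt R)).1 cw.
move/cvgrPdist_le : wl => /(_ _ e0)[d1 /= d10 h1].
move/cvgrPdist_le : wr => /(_ _ e0)[d2 /= d20 h2].
have pi0 := pi_gt0 R.
near=> N.
have rd1 : 2 / N.+1%:R < d1 by near: N; exact: near_div_small.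
have rd2 : 2 / N.+1%:R < d2 by near: N; exact: near_div_small.
have rpi : 2 / N.+1%:R < pi :> R by near: N; exact: near_div_small.
have m0 : 0 < N.+1%:R :> R by rewrite ltr0n.
have r0 : 0 < 2 / N.+1%:R :> R by rewrite divr_gt0.
set r : R := 2 / N.+1%:R; rewrite -/r in rd1 rd2 rpi r0.
pose K := e * (2 * N.+1%:R * M).
have K0 : 0 <= K by apply: mulr_ge0; [exact: ltW|rewrite !mulr_ge0].
have [iB IB] := Rintegral_edges K (ltW r0) (ltW rpi).
rewrite /ip; apply: (le_trans (le_norm_Rint (sqint_mul swc (sd N)) iB _)).
  move=> x Dx; move: (Dx); rewrite /circle/= in_itv/= => /andP[x1 x2].
  have dE : `|w x - c| * `|dcutoff N x| <= e * (2 * N.+1%:R * M) \/ dcutoff N x = 0.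
    have [xl|xl] := leP x (- pi + r).
      left; apply: ler_pM => //; last exact: dcutoff_bound.
      move: x1; rewrite le_eqVlt => /predU1P[<-|x1].
        by rewrite wpi subrr normr0 ltW.
      rewrite distrC /c -wpi; apply: h1 => //=.
      by rewrite ltr0_norm; lra.
    have [xr|xr] := leP (pi - r) x.
      left; apply: ler_pM => //; last exact: dcutoff_bound.
      move: x2; rewrite le_eqVlt => /predU1P[->|x2].
        by rewrite subrr normr0 ltW.
      rewrite distrC /c; apply: h2 => //=.
      by rewrite gtr0_norm; lra.
    by right; apply: dcutoff_eq0.
  rewrite normrM /=.
  have i1 : 0 <= \1_(edges_left r) x :> R by rewrite indicE.
  have i2 : 0 <= \1_(edges_right r) x :> R by rewrite indicE.
  have [->|dn0] := eqVneq (dcutoff N x) 0.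
    by rewrite normr0 mulr0 mulr_ge0// addr_ge0.
  case: dE => [hle|d0]; last by rewrite d0 eqxx in dn0.
  apply: (le_trans hle); rewrite -/K ler_peMr//.
  have [xl|xl] := leP x (- pi + r).
    by rewrite !indicE mem_set ?lerDl// /edges_left/= in_itv/= x1.
  have [xr|xr] := leP (pi - r) x.
    rewrite addrC !indicE mem_set ?lerDl// /edges_right/= in_itv/= x2.
    by rewrite xr.
  by rewrite dcutoff_eq0 ?eqxx in dn0.
rewrite IB /K /r.
have -> : e * (2 * N.+1%:R * M) * (2 / N.+1%:R + 2 / N.+1%:R) = e * (8 * M).
  by field; rewrite gt_eqF.
by rewrite /e mulrAC ler_pdivrMr// ler_pM2l//; lra.
Unshelve. all: by end_near. Qed.

Lemma test_function_cutoff N (u : R -> R) : (forall n, smooth_upto n u) ->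
  test_function (fun x => cutoff N x * u x).
Proof.
move=> su; split.
  apply: smooth_upto_derivable => n; apply: smooth_uptoM => //.
  exact: smooth_upto_cutoff.
exists (- pi + N.+1%:R^-1), (pi - N.+1%:R^-1); split.
- by rewrite ltrDl invr_gt0.
- by rewrite gtrBl invr_gt0.
- by move=> x /cutoff_eq0 ->; rewrite mul0r.
Qed.

Theorem weak_derivative_ip (f F g u u' : R -> R) : sqint f ->
  weak_derivative f g -> {within D, continuous F} ->
  {ae mu, forall x, D x -> F x = f x} -> F (- pi) = F pi ->
  (forall n, smooth_upto n u) -> (forall x : R, is_derive x 1 u (u' x)) ->
  continuous u' -> u (- pi) = u pi ->
  ip g u = - ip f u'.
Proof.
move=> sf [/L2_circleP sg hw] cF Ff Fpi su du cu' upi.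
have cu : continuous u := is_derive_continuous du.
have eqN N : ip f (fun x => dcutoff N x * u x) + ip f (fun x => cutoff N x * u' x) =
    - ip g (fun x => cutoff N x * u x).
  rewrite -[RHS](hw _ (test_function_cutoff N su)) ipC (ipC _ (fun x => cutoff N x * _)).
  rewrite -ipDl//; [|exact: sqint_mul_continuous (@dcutoff_continuous R N) cu
    |exact: sqint_mul_continuous (@cutoff_continuous R N) cu'].
  rewrite ipC; apply: eq_Rintegral => x _; congr (_ * _).
  by rewrite derive1E; have [_ ->] := is_derive_mulf (is_derive_cutoff N x) (du x).
have cFu : {within D, continuous (fun x => F x * u x)}.
  apply/subspace_continuousP => x Dx; apply: cvgM.
    by move/subspace_continuousP : cF; exact.
  by apply: cvg_within_filter; exact: cu.
have lim1 : (fun N => ip f (fun x => dcutoff N x * u x)) @ \oo --> (0 : R).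
  rewrite [X in X @ _](_ : _ = fun N => ip (fun x => F x * u x) (dcutoff N)).
    by apply: ip_dcutoff_cvg0 => //; rewrite Fpi upi.
  (* [f] is replaced by [F] under the integral, continuity being known only for the
     representative. *)
  apply/funext => N; rewrite -(@ip_ae_eq _ F f)//.
  - by apply: eq_Rintegral => x _; rewrite mulrA mulrAC.
  - by case: (sqint_within_continuous cF).
  - by case: sf.
  - by case: (sqint_mul_continuous (@dcutoff_continuous R N) cu).
have lim2 : (fun N => ip f (fun x => dcutoff N x * u x) +
    ip f (fun x => cutoff N x * u' x)) @ \oo --> ip f u'.
  by have := cvgD lim1 (ip_cutoff_cvg sf cu'); rewrite add0r; apply.
have lim3 : (fun N => - ip g (fun x => cutoff N x * u x)) @ \oo --> - ip g u.
  by apply: cvgN; exact: ip_cutoff_cvg.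
have lim4 : (fun N => - ip g (fun x => cutoff N x * u x)) @ \oo --> ip f u'.
  by under eq_fun do rewrite -eqN; exact: lim2.
by rewrite -(cvg_unique _ lim3 lim4) ?opprK//; exact: Rhausdorff.
Qed.

(** Differentiation exchanges [cosn k] and [sinn k] up to sign and a factor k, so the sum of the two
    squared coefficients is multiplied by k^2. *)
Theorem weak_derivative_energy (f g : R -> R) : sqint f -> H1_circle f ->
  weak_derivative f g -> forall k, fourier_energy g k = k%:R ^+ 2 * fourier_energy f k.
Proof.
move=> sf [_ [F [cF Ff Fpi]]] wg k.
have scos n : smooth_upto n (cosn k : R -> R).
  have := @smooth_upto_trig_block R n (fun=> 1) (fun=> 0) k.
  by congr smooth_upto; apply/funext => x; rewrite /trig_block mul1r mul0r addr0.
have ssin n : smooth_upto n (sinn k : R -> R).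
  have := @smooth_upto_trig_block R n (fun=> 0) (fun=> 1) k.
  by congr smooth_upto; apply/funext => x; rewrite /trig_block mul1r mul0r add0r.
have gcos : ip g (cosn k) = k%:R * ip f (sinn k).
  have dc (x : R) : is_derive x 1 (cosn k) (- k%:R * sinn k x).
    by apply: (is_derive_eq (is_derive_cosn k x)); rewrite mulNr.
  rewrite (weak_derivative_ip sf wg cF Ff Fpi scos dc).
  - by rewrite ipC ipZl ?(ipC f) ?mulNr ?opprK//; exact: sqint_sinn.
  - by move=> x; apply: cvgMl_tmp; exact: sinn_continuous.
  - by rewrite cosnN.
have gsin : ip g (sinn k) = - (k%:R * ip f (cosn k)).
  rewrite (weak_derivative_ip sf wg cF Ff Fpi ssin (@is_derive_sinn R k)).
  - by rewrite ipC ipZl ?(ipC f)//; exact: sqint_cosn.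
  - by move=> x; apply: cvgMl_tmp; exact: cosn_continuous.
  - by rewrite sinnN sinn_pi oppr0.
by rewrite /fourier_energy gcos gsin; field; rewrite gt_eqF// trig_norm_gt0.
Qed.

End weak_derivative_coefficients.

(** * Reconstruction of a weak derivative *)

Section sobolev_from_energy.
Context {R : realType}.
Notation mu := (@lebesgue_measure R).
Notation D := (@circle R).
Notation intg f := (mu.-integrable D (EFin \o f)).
Let measurable_D := @measurable_circle R.
Hint Resolve measurable_D : core.

Lemma is_derive_trig_sum (c d : nat -> R) n (x : R) :
  is_derive x 1 (fun y => \sum_(k < n) trig_block c d k y)
    (\sum_(k < n) trig_block (fun k => k%:R * d k) (fun k => - (k%:R * c k)) k x).
Proof.
elim: n => [|n ih].
  by under eq_fun do rewrite big_ord0; rewrite big_ord0; exact: is_derive_cst.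
under eq_fun do rewrite big_ord_recr/=; rewrite big_ord_recr/=.
apply: is_derive_addf => //.
apply: (is_derive_eq (is_derive_addf (is_derive_scalef (c n) (is_derive_cosn n x))
  (is_derive_scalef (d n) (is_derive_sinn n x)))).
by rewrite /trig_block; ring.
Qed.

Lemma trig_sum_continuous (c d : nat -> R) n :
  continuous (fun x => \sum_(k < n) trig_block c d k x).
Proof. exact: is_derive_continuous (is_derive_trig_sum c d n). Qed.

Lemma trig_sum_periodic (c d : nat -> R) n :
  \sum_(k < n) trig_block c d k (- pi) = \sum_(k < n) trig_block c d k pi.
Proof.
apply: eq_bigr => k _.
by rewrite /trig_block cosnN sinnN sinn_pi oppr0.
Qed.

Lemma inv_sqr_sum_le n : \sum_(k < n) (k.+1%:R ^+ 2)^-1 <= 2 :> R.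
Proof.
(* The induction carries the telescoping majorant 2 - 1/(n+1). *)
suff : \sum_(k < n.+1) (k.+1%:R ^+ 2)^-1 <= 2 - (n.+1%:R)^-1 :> R.
  rewrite big_ord_recr/= => h.
  have h1 : 0 <= (n.+1%:R ^+ 2)^-1 :> R by rewrite invr_ge0 sqr_ge0.
  have h2 : 0 <= (n.+1%:R)^-1 :> R by rewrite invr_ge0.
  by move: h h1 h2; set a := \sum_(k < n) _; set b := _^-1; set e := _^-1; lra.
elim: n => [|n ih].
  by rewrite big_ord_recr big_ord0/= add0r expr1n invr1; lra.
rewrite big_ord_recr/=; apply: le_trans (lerD ih (lexx _)) _.
have n0 : 0 < n.+1%:R :> R by rewrite ltr0n.
rewrite -(natr1 n.+1); move: (n.+1%:R : R) n0 => m m0.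
have -> : (2 - m^-1 + ((m + 1) ^+ 2)^-1 : R) =
    2 - (m + 1)^-1 - (m * (m + 1) ^+ 2)^-1.
  by field; rewrite !gt_eqF//; lra.
by rewrite gerBl invr_ge0 mulr_ge0 ?sqr_ge0// ltW.
Qed.

(** [weighted_abs_le] with weight k^-2 gives |c k| <= (k^-2 + k^2 (c k)^2) / 2. Index 0, which the
    hypothesis does not control, is kept apart; the 2 in the witness comes from [inv_sqr_sum_le]. *)
Lemma dirichlet_summable (c : nat -> R) (C : R) :
  (forall n, \sum_(k < n) k%:R ^+ 2 * c k ^+ 2 <= C) ->
  exists B, forall n, \sum_(k < n) `|c k| <= B.
Proof.
move=> hC; exists (`|c 0%N| + (2 + C) / 2) => n.
have C0 : 0 <= C by have := hC 0%N; rewrite big_ord0.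
case: n => [|n]; first by rewrite big_ord0 addr_ge0// divr_ge0// addr_ge0.
rewrite big_ord_recl lerD2l.
have := hC n.+1; rewrite big_ord_recl/= expr0n !mul0r add0r => hn.
have hs := inv_sqr_sum_le n.
apply: (@le_trans _ _
  (\sum_(k < n) ((k.+1%:R ^+ 2)^-1 + k.+1%:R ^+ 2 * c k.+1 ^+ 2) / 2)).
  apply: ler_sum => k _ /=; rewrite /bump/= add1n.
  have k0 : 0 < (k.+1%:R ^+ 2)^-1 :> R by rewrite invr_gt0 exprn_gt0// ltr0n.
  by have := weighted_abs_le (c k.+1) k0; rewrite invrK.
rewrite -mulr_suml big_split/= ler_pM2r// lerD//.
Qed.

Section construction.
Variables (f : R -> R) (C : R).
Hypothesis sf : sqint f.
Hypothesis hC : forall n, \sum_(k < n) k%:R ^+ 2 * fourier_energy f k <= C.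

Let c := fourier_cos f.
Let d := fourier_sin f.
Let c' k := k%:R * d k.
Let d' k := - (k%:R * c k).
Let S n x := \sum_(k < n) trig_block c d k x.

Let tn0 k : trig_norm k != 0 :> R. Proof. by rewrite gt_eqF// trig_norm_gt0. Qed.

Let energyE k : (c k ^+ 2 + d k ^+ 2) * trig_norm k = fourier_energy f k.
Proof.
by rewrite /c /d /fourier_cos /fourier_sin /fourier_energy; field; exact: tn0.
Qed.

Let d0 : d 0%N = 0. Proof. by rewrite /d /fourier_sin ip_sinn0 mul0r. Qed.

Let sS n : sqint (S n). Proof. by apply: sqint_sum => k; exact: sqint_trig_block. Qed.

Let sqr_le_energy k : k%:R ^+ 2 * c k ^+ 2 <= k%:R ^+ 2 * fourier_energy f k /\
  k%:R ^+ 2 * d k ^+ 2 <= k%:R ^+ 2 * fourier_energy f k.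
Proof.
rewrite -energyE; have := @trig_norm_ge1 R k; set m := trig_norm k => m1.
have hc := sqr_ge0 (c k); have hd := sqr_ge0 (d k).
by split; rewrite ler_wpM2l ?sqr_ge0//; nra.
Qed.

Let block_summable : exists B, forall n, \sum_(k < n) (`|c k| + `|d k|) <= B.
Proof.
have [n|B1 h1] := @dirichlet_summable c C.
  apply: le_trans (hC n); apply: ler_sum => k _.
  by have [] := sqr_le_energy k.
have [n|B2 h2] := @dirichlet_summable d C.
  apply: le_trans (hC n); apply: ler_sum => k _.
  by have [] := sqr_le_energy k.
exists (B1 + B2) => n; rewrite big_split/=.
exact: lerD (h1 n) (h2 n).
Qed.

(** Weierstrass test: [e n] is the tail of the series of |c k| + |d k|. *)
Let uniform_limit : exists (F : R -> R) (e : nat -> R), e @ \oo --> (0 : R) /\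
  forall n x, `|F x - S n x| <= e n.
Proof.
have [B hB] := block_summable.
pose T n := \sum_(k < n) (`|c k| + `|d k|).
have ndT : nondecreasing_seq T.
  by apply/nondecreasing_seqP => n; rewrite /T big_ord_recr/= lerDl addr_ge0.
have cT : cvgn T by apply: nondecreasing_is_cvgn => //; exists B => _ [n _ <-]; exact: hB.
have blk_le k x : `|trig_block c d k x| <= `|c k| + `|d k|.
  apply: le_trans (ler_normD _ _) _; rewrite !normrM.
  by apply: lerD; rewrite ler_piMr// ?cos_max ?sin_max.
have SB n m x : (n <= m)%N -> `|S m x - S n x| <= T m - T n.
  move=> nm; rewrite -(subnKC nm); elim: (m - n)%N => [|j ih].
    by rewrite addn0 !subrr normr0.
  rewrite addnS /S /T !big_ord_recr/= -/(S _ x) -/(T _).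
  rewrite addrAC [leRHS]addrAC; apply: le_trans (ler_normD _ _) _.
  exact: lerD.
have cS x : cvgn (fun n => S n x).
  have : cvgn (series (fun k => trig_block c d k x)).
    apply: normed_cvg; apply: (series_le_cvg (v_ := fun k => `|c k| + `|d k|)) => //.
    - by move=> n; exact: normr_ge0.
    - by move=> n; exact: blk_le.
    - by rewrite /series/=; under eq_fun do rewrite big_mkord.
  by rewrite /series/=; under eq_fun do rewrite big_mkord.
exists (fun x => limn (fun n => S n x)), (fun n => limn T - T n); split.
  rewrite -(subrr (limn T)); apply: cvgB; [exact: cvg_cst|exact: cT].
move=> n x.
have h1 : `|S m x - S n x| @[m --> \oo] --> `|limn (fun n => S n x) - S n x|.
  by apply: cvg_norm; apply: cvgB; [exact: cS|exact: cvg_cst].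
have h2 : T m - T n @[m --> \oo] --> limn T - T n.
  by apply: cvgB; [exact: cT|exact: cvg_cst].
apply: (ler_cvg_to h1 h2); exists n => // m /= nm; exact: SB.
Qed.

(** Two limits of the same partial sums are compared: the uniform one, [F], is continuous and
    periodic; the weak one, [h], has the Fourier coefficients of [f]. They have the same inner
    products with square integrable functions, so [F] has the coefficients of [f], and
    [trig_uniqueness] gives [F = f] almost everywhere. *)
Theorem H1_circle_of_energy : H1_circle f.
Proof.
have [F [e [e0 FS]]] := uniform_limit.
have SF x : (fun n => S n x) @ \oo --> F x.
  apply/cvgrPdist_le => eps eps0.
  move/cvgr0Pnorm_le : e0 => /(_ _ eps0); apply: filterS => n en.
  by apply: le_trans (FS n x) _; apply: le_trans (ler_norm _) en.
have contF : continuous F.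
  move=> x; apply/cvgrPdist_le => eps eps0.
  have eps3 : 0 < eps / 3 by rewrite divr_gt0.
  move/cvgr0Pnorm_le : (e0) => /(_ _ eps3)[n _ /(_ n (leqnn n)) en].
  have {}en : e n <= eps / 3 := le_trans (ler_norm _) en.
  have /cvgrPdist_le/(_ _ eps3) := @trig_sum_continuous c d n x.
  apply: filterS => y hy.
  have h1 := FS n x; have h2 := FS n y; rewrite -/(S n x) -/(S n y) in hy.
  have -> : F x - F y = (F x - S n x) + (S n x - S n y) - (F y - S n y) by ring.
  apply: le_trans (ler_normB _ _) _.
  apply: le_trans (lerD (ler_normD _ _) (lexx _)) _.
  lra.
have sF : sqint F by exact: sqint_continuous.
have Fpi : F (- pi) = F pi.
  rewrite -(cvg_lim (@Rhausdorff R) (SF (- pi))) -(cvg_lim (@Rhausdorff R) (SF pi)).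
  by congr (limn _); apply/funext => n; exact: trig_sum_periodic.
have SFip v : sqint v -> (fun n => ip (S n) v) @ \oo --> ip F v.
  move=> sv; have sFS n : sqint (fun x => F x - S n x) := sqintB sF (sS n).
  have iv := integrable_norm (sqint_intg sv).
  pose K := \int[mu]_(x in D) `|v x|.
  apply/cvgrPdist_le => eps eps0.
  have K0 : 0 <= K by apply: Rintegral_ge0.
  have epsK : 0 < eps / (K + 1) by rewrite divr_gt0// ltr_wpDl.
  move/cvgr0Pnorm_le : (e0) => /(_ _ epsK); apply: filterS => n en.
  have {}en : e n <= eps / (K + 1) := le_trans (ler_norm _) en.
  rewrite -ipBl//; apply: (@le_trans _ _ (e n * K)).
    rewrite /K -RintZ//; apply: le_norm_Rint; [exact: sqint_mul|exact: intgZ|].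
    by move=> x _; rewrite normrM ler_wpM2r.
  apply: (@le_trans _ _ (eps / (K + 1) * K)); first by rewrite ler_wpM2r.
  by rewrite mulrAC ler_pdivrMr ?ltr_wpDl// ler_pM2l// lerDl.
have [n|h [sh hc hw _]] := @trig_series_converges R c d d0 (ip f f).
  by under eq_bigr do rewrite energyE; exact: bessel.
have Fh v : sqint v -> ip F v = ip h v.
  by move=> sv; apply: (cvg_unique _ (SFip v sv) (hw v sv)); exact: Rhausdorff.
have Ff : {ae mu, forall x, D x -> F x = f x}.
  suff : {ae mu, forall x, D x -> F x - f x = 0}.
    by apply: ae_mono => x /[apply] /eqP; rewrite subr_eq0 => /eqP.
  apply: trig_uniqueness; first exact: sqintB.
  - move=> k; have sk := sqint_cosn k; rewrite ipBl// Fh// (hc k).1.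
    by rewrite /c /fourier_cos divfK ?subrr.
  - move=> k; have sk := sqint_sinn k; rewrite ipBl// Fh// (hc k).2.
    by rewrite /d /fourier_sin divfK ?subrr.
split; last first.
  by exists F; split => //; exact: continuous_subspaceT.
split; first exact/L2_circleP.
have d'0 : d' 0%N = 0 by rewrite /d' mul0r oppr0.
(* The energies of the termwise derivative are k^2 times those of [f], so [C] bounds their partial
   sums. *)
have [n|g [sg _ gw _]] := @trig_series_converges R c' d' d'0 C.
  apply: le_trans (hC n); apply: ler_sum => k _; rewrite -energyE /c' /d'.
  by rewrite le_eqVlt; apply/orP; left; apply/eqP; ring.
exists g; split; first exact/L2_circleP.
move=> phi [dphi [a [b [a1 b1 phi0]]]].
pose phi' := (phi^`())%classic.
have dphi1 (x : R) : is_derive x 1 phi (phi' x).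
  by rewrite /phi' derive1E; apply: derivableP; exact: (dphi 0%N).
have cphi : continuous phi := is_derive_continuous dphi1.
have cphi' : continuous phi'.
  move=> x; apply/differentiable_continuous/derivable1_diffP; exact: (dphi 1%N).
have sphi := sqint_continuous cphi; have sphi' := sqint_continuous cphi'.
have phipi : phi pi = 0 /\ phi (- pi) = 0.
  by split; apply: phi0; rewrite in_itv/= negb_and -!ltNge ?a1 ?b1 ?orbT.
(* Integration by parts for partial sums; the boundary terms vanish because [phi] does at both
   ends. *)
have parts n : ip (S n) phi' = - ip (fun x => \sum_(k < n) trig_block c' d' k x) phi.
  have sS' : sqint (fun x => \sum_(k < n) trig_block c' d' k x).
    by apply: sqint_sum => k; exact: sqint_trig_block.
  apply/eqP; rewrite -addr_eq0 addrC /ip -RintD; [|exact: sqint_mul..].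
  have dSphi (x : R) : is_derive x 1 (fun y => S n y * phi y)
      ((\sum_(k < n) trig_block c' d' k x) * phi x + S n x * phi' x).
    by apply: is_derive_mulf; exact: is_derive_trig_sum.
  rewrite (circle_FTC2 dSphi).
  - by rewrite phipi.1 phipi.2 !mulr0 subrr.
  - apply: continuous_subspaceT => x; apply: cvgD; apply: cvgM.
    + exact: trig_sum_continuous.
    + exact: cphi.
    + exact: trig_sum_continuous.
    + exact: cphi'.
have lim1 := SFip phi' sphi'.
have lim2 : (fun n => - ip (fun x => \sum_(k < n) trig_block c' d' k x) phi) @ \oo -->
    - ip g phi.
  by apply: cvgN; exact: gw.
rewrite -[LHS]/(ip f phi') -[X in _ = - X]/(ip g phi).
rewrite -(@ip_ae_eq _ F f phi')//; [|by case: sF|by case: sf|by case: sphi'].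
have lim3 : (fun n => ip (S n) phi') @ \oo --> - ip g phi.
  by under eq_fun do rewrite parts; exact: lim2.
exact: (cvg_unique (@Rhausdorff R) lim1 lim3).
Qed.

End construction.
End sobolev_from_energy.

Unset Implicit Arguments.

Theorem lemma3p15 (R : realType) (f : R -> R) :
  L2_circle f ->
  [/\ (forall t y : R, 0 < t ->
         has_bilateral_sum
           (fun k : int => (expR (- (k%:~R ^+ 2 * t)))%:C * expi (k%:~R * y))
           ((2 * pi * heat_kernel t y)%:C)),
      (H1_circle f <->
         exists C : R, forall t : R, 0 < t -> `|J f t| <= C) &
      (H1_circle f ->
         (forall s t : R, 0 < s -> s <= t -> J f t <= J f s) /\
         (forall g : R -> R, weak_derivative f g ->
            J f t @[t --> 0^'+] --> L2norm g ^+ 2))].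
Proof.
move=> /L2_circleP sf; split.
- by move=> t y t0; exact: heat_kernel_bilateral.
- split=> [H1|[C hC]].
    have [[_ [g wg]] _] := H1.
    have sg : sqint g by case: wg => /L2_circleP.
    (* The bound is the squared norm of the weak derivative: its energies are k^2 times those of
       [f], and Bessel bounds their sums. *)
    exists (ip g g) => t t0; rewrite ger0_norm; last exact: J_ge0.
    apply: J_le_dirichlet => // n.
    under eq_bigr do rewrite -(weak_derivative_energy sf H1 wg).
    exact: bessel.
  apply: (@H1_circle_of_energy _ _ C) => //; apply: dirichlet_sum_bounded => // t t0.
  exact: le_trans (ler_norm _) (hC t t0).
- move=> H1; split=> [s t s0 st|g wg]; first exact: J_nonincreasing.
  have sg : sqint g by case: wg => /L2_circleP.
  apply: J_cvg => //; rewrite L2norm_sqr//.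
  (* The Dirichlet sums of [f] are the Parseval sums of [g]. *)
  under eq_fun do under eq_bigr do rewrite -(weak_derivative_energy sf H1 wg).
  exact: parseval.
Qed.
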